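(* Let $S\subset C(\mathbf{k})$ be finite and $F\in K[x_1,\dots,x_n]$ a polynomial of degree $d>0$ with $F(0,\dots,0)\ne0$ and such that one of its coefficients equals $1$. Put $N:=\binom{n+d}{n}-1$. Let $\mathbf g=(g_1,\dots,g_n)\in(\mathcal{O}_S^* )^n$ and let $r$ be a positive integer, and suppose that the elements $\mathbf g^{\mathbf i}$ with $\mathbf i\in\mathbb{Z}_{\ge0}^n$, $|\mathbf i|\le d$, are linearly nondegenerate over $V_F(r)$. Then $$\sum_{\mathfrak p\in S}v^0_{\mathfrak p}(F(\mathbf g))\le\Bigl(\tfrac{d_r}{d_{r-1}}-1\Bigr)(N+1)dn\max_{1\le i\le n}h(g_i)+\tfrac{d_r(N+1)}{d_{r-1}}(r+1)h(F)+\tfrac{d_r(N+1)(Nd_r+d_r-1)}{2d_{r-1}}\max\{0,2\mathfrak g-2+|S|\}.$$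
   Context: $\mathbf{k}$ is an algebraically closed field of characteristic zero, $C$ a smooth projective curve over $\mathbf{k}$ of genus $\mathfrak g$, $K=\mathbf{k}(C)$; $v_{\mathfrak p}$ is the order-of-vanishing valuation at $\mathfrak p\in C(\mathbf{k})$, $v^0_{\mathfrak p}(f)=\max\{0,v_{\mathfrak p}(f)\}$ (with $v^0_{\mathfrak p}(0)=+\infty$). $\mathcal{O}_S^*=\{f\in K^*: v_{\mathfrak p}(f)=0\ \forall\mathfrak p\notin S\}$. For $f\in K^*$, $h(f)=\sum_{\mathfrak p}\max\{0,-v_{\mathfrak p}(f)\}$. For nonzero $F=\sum a_{\mathbf i}\mathbf x^{\mathbf i}$, $h(F)=-\sum_{\mathfrak p}\min_{a_{\mathbf i}\ne0}v_{\mathfrak p}(a_{\mathbf i})$. $\mathbf g^{\mathbf i}=g_1^{i_1}\cdots g_n^{i_n}$, $|\mathbf i|=i_1+\cdots+i_n$. For an integer $s\ge0$, $V_F(s)$ is the $\mathbf{k}$-vector subspace of $K$ spanned by all products $\prod_\alpha\alpha^{n_\alpha}$, $\alpha$ running over the nonzero coefficients of $F$, $n_\alpha\ge0$, $\sum n_\alpha=s$ (so $V_F(0)=\mathbf{k}$); $d_s:=\dim_{\mathbf{k}}V_F(s)$. For a $\mathbf{k}$-subspace $E\subset K$, elements $y_1,\dots,y_N\in K$ are linearly nondegenerate over $E$ if $\sum a_iy_i=0$ with all $a_i\in E$ implies all $a_i=0$. *)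

(* Defs.v *)
From HB Require Import structures.
From mathcomp Require Import all_boot all_order all_algebra.
From mathcomp Require Import mpoly.
From mathcomp Require Import boolp classical_sets cardinality fsbigop constructive_ereal.
Set Implicit Arguments. Unset Strict Implicit. Unset Printing Implicit Defensive.
Import Order.TTheory GRing.Theory Num.Theory.
Local Open Scope ring_scope.
Local Open Scope classical_set_scope.

Section FunctionField.
Variables (k : closedFieldType) (K : fieldType) (iota : {rmorphism k -> K}).

(** K is a function field of one variable over k: there is t transcendental
    over k such that K is a finite-dimensional k(t)-vector space. Since k is
    algebraically closed, this is exactly K = k(C) for a (unique) smooth
    projective curve C over k. *)
Definition ktrans (t : K) : Prop :=
  forall p : {poly k}, (map_poly iota p).[t] = 0 -> p = 0.
Definition in_kt (t x : K) : Prop :=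
  exists p q : {poly k}, (map_poly iota q).[t] != 0 /\
    x = (map_poly iota p).[t] / (map_poly iota q).[t].
Definition is_function_field : Prop :=
  exists t : K, ktrans t /\ exists b : seq K, forall x : K,
    exists r : 'I_(size b) -> K, (forall i, in_kt t (r i)) /\
      x = \sum_(i < size b) r i * b`_i.

(** Points p of C(k) = normalized discrete valuations of K trivial on k
    (residue field k, as k is algebraically closed).  v_p(0) is set to 0 by
    convention; the case f = 0 is always treated separately below. *)
Definition is_place (v : K -> int) : Prop :=
  [/\ v 0 = 0,
      forall x y, x != 0 -> y != 0 -> v (x * y) = v x + v y,
      forall x y, x != 0 -> y != 0 -> x + y != 0 -> Num.min (v x) (v y) <= v (x + y),
      forall c, c != 0 -> v (iota c) = 0
    & exists x, v x = 1].

Record place := Place { pval :> K -> int; pvalP : is_place pval }.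
HB.instance Definition _ := gen_eqMixin place.
HB.instance Definition _ := gen_choiceMixin place.

Definition kfree (b : seq K) : Prop :=
  forall c : 'I_(size b) -> k,
    \sum_(i < size b) iota (c i) * b`_i = 0 -> forall i, c i = 0.
Definition in_kspan (b : seq K) (x : K) : Prop :=
  exists c : 'I_(size b) -> k, x = \sum_(i < size b) iota (c i) * b`_i.
Definition kdim (b : seq K) : nat :=
  \max_(I : {set 'I_(size b)} | `[< kfree [seq nth 0 b (val i) | i <- enum I] >]) #|I|.

Definition is_divisor (D : place -> int) : Prop := finite_set [set p | D p != 0].
Definition deg (D : place -> int) : int := \sum_(p \in [set: place]) D p.
Definition inL (D : place -> int) (f : K) : Prop :=
  f = 0 \/ forall p : place, - D p <= p f.
Definition is_genus (gen : nat) : Prop :=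
  forall D, is_divisor D -> (2 * gen%:Z - 1 <= deg D) ->
    exists b : seq K, [/\ all (fun x => `[< inL D x >]) b, kfree b,
      (forall x, inL D x -> in_kspan b x) & (size b)%:Z = deg D + 1 - gen%:Z].

Definition hgt (f : K) : int := \sum_(p \in [set: place]) Num.max 0 (- p f).

Definition v0 (p : place) (f : K) : \bar rat :=
  if f == 0 then +oo%E else ((Num.max 0 (p f))%:~R)%:E.

Definition OSunit (S : seq place) (f : K) : Prop :=
  f != 0 /\ forall p : place, p \notin S -> p f = 0.

Variable n : nat.

Definition coefs (F : {mpoly K[n]}) : seq K := undup [seq F@_m | m <- msupp F].

Definition minv (p : place) (s : seq K) : int :=
  \big[Num.min/p (head 0 s)]_(c <- s) p c.
Definition hpoly (F : {mpoly K[n]}) : int :=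
  - \sum_(p \in [set: place]) minv p (coefs F).

Definition gensV (F : {mpoly K[n]}) (s : nat) : seq K :=
  [seq \prod_(i < size (coefs F)) (coefs F)`_i ^+ (e i : nat)
  | e : {ffun 'I_(size (coefs F)) -> 'I_s.+1} <- enum [set e : {ffun 'I_(size (coefs F)) -> 'I_s.+1}
               | (\sum_(i < size (coefs F)) (e i : nat) == s)%N]].
Definition inV (F : {mpoly K[n]}) (s : nat) (x : K) : Prop := in_kspan (gensV F s) x.
Definition dimV (F : {mpoly K[n]}) (s : nat) : nat := kdim (gensV F s).

Definition gmonos (g : 'I_n -> K) (d : nat) : seq K :=
  [seq \prod_(j < n) g j ^+ (i j : nat)
  | i : {ffun 'I_n -> 'I_d.+1} <- enum [set i : {ffun 'I_n -> 'I_d.+1} | (\sum_(j < n) (i j : nat) <= d)%N]].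

Definition lin_nondeg (E : K -> Prop) (y : seq K) : Prop :=
  forall a : 'I_(size y) -> K, (forall j, E (a j)) ->
    \sum_(j < size y) a j * y`_j = 0 -> forall j, a j = 0.

End FunctionField.

(* Main.v *)
(** Let [b] run over a basis of [V_F(r)] and [g^i] over the monomials of degree at most [d].
    Nondegeneracy makes the [M = d_r (N + 1)] products [b * g^i] linearly independent over [k],
    so their Wronskian [W] for a derivation [D] of [K/k] is a nonzero element of [K] and the sum
    of its orders vanishes.  At a point of [S] where [F(g)] vanishes, [d_(r-1)] of the products
    [b * g^0] may be traded for the products of [F(g)] with a basis of [V_F(r-1)], because
    [F(0) <> 0]; this bounds the order of [W] below by [d_(r-1) v(F(g))] plus terms that add up,
    by the product formula for the [S]-units [g^i], to a multiple of [h(F)] and of [M (M - 1) / 2]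
    times the degree of the divisor of [D].

    That degree must be compared with the genus, which is only given by Riemann-Roch in large
    degree.  Fix a point [q] and a function [t] whose only pole is [q], of order [n = 2 gen + 1].
    The functions regular off [q] form a free [k[t]]-module with a basis having pole orders
    distinct modulo [n]; counting gaps bounds the degree of the discriminant of its trace form
    by [n - 1 + 2 gen].  A function vanishing on a whole fibre of [t] is nilpotent modulo [t - c],
    so the discriminant vanishes at [c] to order at least the sum of the [e_p - 1], and
    [deg (dt) <= 2 gen - 2].  The derivation [d/dt] itself comes from coordinatewise
    differentiation, corrected by means of the separability (Casimir) element of the trace form. *)
Require Import Defs.
From HB Require Import structures.
From mathcomp Require Import all_boot all_order all_algebra.
From mathcomp Require Import mpoly.
From mathcomp Require Import boolp classical_sets cardinality fsbigop constructive_ereal.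
From mathcomp Require Import perm.
From mathcomp Require Import ring lra zify.
Set Implicit Arguments. Unset Strict Implicit. Unset Printing Implicit Defensive.
Import Order.TTheory GRing.Theory Num.Theory.
Local Open Scope ring_scope.

(** * Valuations *)

(** Two different local estimates of the Wronskian meet. At a point of [S] the columns have
    unrelated orders, so each keeps its own and every derivative may cost one extra order; the
    orders of the [g^i] then cancel in the sum over [S]. Off [S] the [g^i] are units, all columns
    share one lower bound, and rescaling the derivation removes that extra loss. The difference, one
    order per derivative at each point of [S], is the |S| in 2 gen - 2 + |S|. No height of [g]
    survives in this estimate; the corresponding term of the theorem is nonnegative and is added at
    the end. Since [is_genus] speaks only of degrees at least 2 gen - 1, the product formula and the
    finiteness of supports are themselves drawn from dimension counts in that range. The pole order
    n = 2 gen + 1 is chosen because all orders from 2 gen on are pole orders at [q]. It leaves no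
    trace in the result: d/dt has order n + 1 at [q] and, over any finite set of other points, total
    order at least -(n - 1 + 2 gen), which leaves 2 - 2 gen. *)

Lemma mulrn_int (a : int) d : a *+ d = a * d%:Z.
Proof. by rewrite -mulr_natr natz. Qed.

Section Valuations.
Variables (k : closedFieldType) (K : fieldType) (iota : {rmorphism k -> K}).
Implicit Types (v : place iota) (x y : K) (m : int).

Lemma pval0 v : v 0 = 0.
Proof. by case: (pvalP v). Qed.

Lemma pvalM v x y : x != 0 -> y != 0 -> v (x * y) = v x + v y.
Proof. by case: (pvalP v) => _ + _ _ _; apply. Qed.

Lemma pvalC v c : v (iota c) = 0.
Proof.
by case: (pvalP v) => v0 _ _ vC _; case: (eqVneq c 0) => [->|/vC//]; rewrite rmorph0.
Qed.

Lemma pval1 v : v 1 = 0.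
Proof. by rewrite -(rmorph1 iota) pvalC. Qed.

Lemma pvalN v x : v (- x) = v x.
Proof.
case: (eqVneq x 0) => [->|x0]; first by rewrite oppr0.
have -> : - x = iota (-1) * x by rewrite rmorphN1 mulN1r.
by rewrite pvalM ?pvalC ?add0r // rmorphN1 oppr_eq0 oner_eq0.
Qed.

Lemma pvalV v x : v (x^-1) = - v x.
Proof.
case: (eqVneq x 0) => [->|x0]; first by rewrite invr0 pval0 oppr0.
apply/eqP; rewrite -addr_eq0 addrC -pvalM ?invr_eq0 // divff ?pval1 //.
Qed.

Lemma pvalX v x n : v (x ^+ n) = v x *+ n.
Proof.
case: (eqVneq x 0) => [->|x0].
  by rewrite expr0n pval0 mul0rn; case: n => [|n]; rewrite ?pval1 ?pval0.
elim: n => [|n IHn]; first by rewrite expr0 pval1.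
by rewrite exprS mulrS pvalM ?IHn // expf_neq0.
Qed.

Lemma pval_prod v (I : Type) (s : seq I) (P : pred I) (f : I -> K) :
  (forall i, P i -> f i != 0) ->
  v (\prod_(i <- s | P i) f i) = \sum_(i <- s | P i) v (f i).
Proof.
move=> f0.
suff [//] : v (\prod_(i <- s | P i) f i) = \sum_(i <- s | P i) v (f i)
  /\ \prod_(i <- s | P i) f i != 0.
elim: s => [|i s [IH1 IH2]]; first by rewrite !big_nil pval1 oner_eq0.
rewrite !big_cons; case: ifP => // Pi.
by rewrite pvalM ?IH1 ?f0 // mulf_neq0 ?f0.
Qed.

(* "x vanishes to order at least m at v"; the convention v 0 = 0 makes the case x = 0 separate. *)
Definition gev v m x := (x == 0) || (m <= v x).

Lemma gev0 v m : gev v m 0.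
Proof. by rewrite /gev eqxx. Qed.

Lemma gevE v m x : x != 0 -> gev v m x = (m <= v x).
Proof. by rewrite /gev => /negPf->. Qed.

Lemma gev_refl v x : gev v (v x) x.
Proof. by rewrite /gev lexx orbT. Qed.

Lemma gevW v m m' x : m' <= m -> gev v m x -> gev v m' x.
Proof. by move=> le_m /orP[/eqP->|/(le_trans le_m) h]; rewrite /gev ?eqxx ?h ?orbT. Qed.

Lemma gevD v m x y : gev v m x -> gev v m y -> gev v m (x + y).
Proof.
rewrite /gev => /orP[/eqP->|hx]; first by rewrite add0r.
case/orP=> [/eqP->|hy]; first by rewrite addr0 hx orbT.
case: (eqVneq (x + y) 0) => //= xy0.
case: (eqVneq x 0) => [->|x0]; first by rewrite add0r.
case: (eqVneq y 0) => [->|y0]; first by rewrite addr0.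
case: (pvalP v) => _ _ /(_ x y x0 y0 xy0) h _ _.
by apply: le_trans h; rewrite le_min hx.
Qed.

Lemma gevN v m x : gev v m (- x) = gev v m x.
Proof. by rewrite /gev oppr_eq0 pvalN. Qed.

Lemma gevB v m x y : gev v m x -> gev v m y -> gev v m (x - y).
Proof. by move=> hx hy; rewrite gevD ?gevN. Qed.

Lemma gevM v m m' x y : gev v m x -> gev v m' y -> gev v (m + m') (x * y).
Proof.
rewrite /gev => /orP[/eqP->|hx]; first by rewrite mul0r eqxx.
case/orP=> [/eqP->|hy]; first by rewrite mulr0 eqxx.
case: (eqVneq x 0) => [->|x0]; first by rewrite mul0r eqxx.
case: (eqVneq y 0) => [->|y0]; first by rewrite mulr0 eqxx.
by rewrite pvalM // lerD // orbT.
Qed.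

Lemma gevMl v m x y : gev v 0 x -> gev v m y -> gev v m (x * y).
Proof. by move=> hx hy; rewrite -[m]add0r gevM. Qed.

Lemma gevC v c : gev v 0 (iota c).
Proof. by rewrite /gev pvalC lexx orbT. Qed.

Lemma gev1 v : gev v 0 1.
Proof. by rewrite /gev pval1 lexx orbT. Qed.

Lemma gevZ v m c x : gev v m x -> gev v m (iota c * x).
Proof. by apply: gevMl; exact: gevC. Qed.

Lemma gevX v m x n : gev v m x -> gev v (m *+ n) (x ^+ n).
Proof.
move=> hx; elim: n => [|n IHn]; first by rewrite expr0 gev1.
by rewrite exprS mulrS gevM.
Qed.

Lemma gev_sum v m (I : Type) (s : seq I) (P : pred I) (f : I -> K) :
  (forall i, P i -> gev v m (f i)) -> gev v m (\sum_(i <- s | P i) f i).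
Proof. by move=> h; elim/big_rec: _ => [|i x Pi hx]; [exact: gev0|rewrite gevD ?h]. Qed.

Lemma gev_prod v (I : Type) (s : seq I) (P : pred I) (f : I -> K) (m : I -> int) :
  (forall i, P i -> gev v (m i) (f i)) ->
  gev v (\sum_(i <- s | P i) m i) (\prod_(i <- s | P i) f i).
Proof.
move=> h; elim: s => [|i s IHs]; first by rewrite !big_nil gev1.
by rewrite !big_cons; case: ifP => // Pi; rewrite gevM ?h.
Qed.

Lemma pvalDl v x y : x != 0 -> gev v (v x + 1) y -> x + y != 0 /\ v (x + y) = v x.
Proof.
move=> x0 hy.
have xy0 : x + y != 0.
  apply: contraL hy; rewrite addrC addr_eq0 => /eqP->.
  by rewrite gevN gevE // gerDl.
split=> //; apply/eqP; rewrite eq_le.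
have h : gev v (v x) (x + y).
  by rewrite gevD ?gev_refl //; apply: gevW hy; rewrite lerDl.
rewrite gevE // in h; rewrite h andbT.
rewrite leNgt; apply/negP => lt_x.
have : gev v (v x + 1) (x + y - y).
  by rewrite gevB // gevE // lezD1.
by rewrite addrK gevE // gerDl.
Qed.

Lemma pval_sum_dominant v (I : finType) (f : I -> K) l : f l != 0 ->
  (forall i, i != l -> gev v (v (f l) + 1) (f i)) ->
  \sum_i f i != 0 /\ v (\sum_i f i) = v (f l).
Proof.
by move=> fl0 hf; rewrite (bigD1 l) //=; apply: pvalDl => //; exact: gev_sum.
Qed.

(** Nonzero terms of pairwise distinct orders cannot cancel: the term of least order dominates the
    sum. *)
Lemma gev_sum_distinct v (I : finType) (f : I -> K) m :
  (forall i j, i != j -> f i != 0 -> f j != 0 -> v (f i) != v (f j)) ->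
  gev v m (\sum_i f i) -> forall i, gev v m (f i).
Proof.
move=> dist hs i; apply/negPn/negP => hi.
have fi0 : f i != 0 by apply: contraNneq hi => ->; rewrite gev0.
have [j fj0 jmin] := @arg_minP _ _ _ i (fun i => f i != 0) (fun i => v (f i)) fi0.
have [|s0 sj] := pval_sum_dominant (v := v) fj0.
  move=> l lj; case: (eqVneq (f l) 0) => [->|fl0]; first exact: gev0.
  by rewrite gevE // lezD1 lt_neqAle jmin // andbT dist // eq_sym.
move: hs; rewrite gevE // sj => le_mj.
by move/negP: hi; apply; rewrite gevE // (le_trans le_mj) // jmin.
Qed.

End Valuations.

(** * Linear algebra over the constants *)

Section KSpan.
Variables (k : closedFieldType) (K : fieldType) (iota : {rmorphism k -> K}).
Implicit Types (b u : seq K) (x y : K).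

Local Notation in_kspan := (in_kspan iota).
Local Notation kfree := (kfree iota).

Lemma kspanP b x :
  in_kspan b x <-> exists c : nat -> k, x = \sum_(i < size b) iota (c i) * b`_i.
Proof.
split=> [[c ->]|[c ->]]; last by exists (fun i => c i).
exists (fun i => if insub i is Some j then c j else 0).
by apply: eq_bigr => i _; rewrite valK.
Qed.

Lemma kfreeP b :
  kfree b <-> forall c : nat -> k,
    \sum_(i < size b) iota (c i) * b`_i = 0 -> forall i, (i < size b)%N -> c i = 0.
Proof.
split=> [fb c h i ib|fb c h i]; first by rewrite -(fb (fun i => c i) h (Ordinal ib)).
have := fb (fun i => if insub i is Some j then c j else 0).
rewrite (_ : \sum_(i < _) _ = 0) => [/(_ erefl i (ltn_ord i))|]; first by rewrite valK.
by rewrite -[RHS]h; apply: eq_bigr => j _; rewrite valK.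
Qed.

Lemma kspan_mem b x : x \in b -> in_kspan b x.
Proof.
move=> xb; apply/kspanP; exists (fun i => (i == index x b)%:R).
have xs : (index x b < size b)%N by rewrite index_mem.
rewrite (bigD1 (Ordinal xs)) //= eqxx rmorph1 mul1r nth_index //.
rewrite big1 ?addr0 // => i /negPf; rewrite -val_eqE /= => ->.
by rewrite rmorph0 mul0r.
Qed.

Lemma kspan0 b : in_kspan b 0.
Proof. by exists (fun=> 0); rewrite big1 // => i _; rewrite rmorph0 mul0r. Qed.

Lemma kspanD b x y : in_kspan b x -> in_kspan b y -> in_kspan b (x + y).
Proof.
move=> [c ->] [d ->]; exists (fun i => c i + d i); rewrite -big_split /=.
by apply: eq_bigr => i _; rewrite rmorphD mulrDl.
Qed.

Lemma kspanZ b a x : in_kspan b x -> in_kspan b (iota a * x).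
Proof.
move=> [c ->]; exists (fun i => a * c i); rewrite mulr_sumr.
by apply: eq_bigr => i _; rewrite rmorphM mulrA.
Qed.

Lemma kspanN b x : in_kspan b x -> in_kspan b (- x).
Proof. by move=> /(kspanZ (-1)); rewrite rmorphN1 mulN1r. Qed.

Lemma kspanB b x y : in_kspan b x -> in_kspan b y -> in_kspan b (x - y).
Proof. by move=> hx /kspanN; exact: kspanD. Qed.

Lemma kspan_sum b (I : Type) (s : seq I) (P : pred I) (f : I -> K) :
  (forall i, P i -> in_kspan b (f i)) -> in_kspan b (\sum_(i <- s | P i) f i).
Proof. by move=> h; elim/big_rec: _ => [|i x Pi hx]; [exact: kspan0|apply: kspanD hx; exact: h]. Qed.

Lemma kspan_trans b b' x :
  (forall y, y \in b -> in_kspan b' y) -> in_kspan b x -> in_kspan b' x.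
Proof.
move=> h [c ->]; apply: kspan_sum => i _; apply: kspanZ; apply: h.
exact: mem_nth.
Qed.

Lemma kspan_sub b b' x : {subset b <= b'} -> in_kspan b x -> in_kspan b' x.
Proof. by move=> sb; apply: kspan_trans => y /sb /kspan_mem. Qed.

Lemma kspan_mull b x y : in_kspan b x -> in_kspan [seq y * z | z <- b] (y * x).
Proof.
move=> [c ->]; rewrite mulr_sumr; apply: kspan_sum => i _.
rewrite mulrCA; apply: kspanZ; apply: kspan_mem; apply: map_f; exact: mem_nth.
Qed.

Lemma kspan_size u b : kfree u -> (forall x, x \in u -> in_kspan b x) ->
  (size u <= size b)%N.
Proof.
move=> fu hu; rewrite leqNgt; apply/negP => lt_bu.
have /choice[c hc] : forall i : 'I_(size u), exists c : 'I_(size b) -> k,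
    u`_i = \sum_(j < size b) iota (c j) * b`_j.
  by move=> i; apply: hu; exact: mem_nth.
pose U := \matrix_(i, j) c i j.
have : kermx U != 0.
  by rewrite -mxrank_eq0 mxrank_ker -lt0n subn_gt0 (leq_ltn_trans (rank_leq_col U)).
case/rowV0Pn => w /sub_kermxP wU /negP; apply; apply/eqP/rowP => i; rewrite mxE.
apply: (fu (fun i => w 0 i)).
under eq_bigr => j _ do rewrite hc mulr_sumr.
rewrite exchange_big /= big1 // => l _.
under eq_bigr => j _ do rewrite mulrA -rmorphM.
rewrite -mulr_suml -rmorph_sum /=.
have /rowP/(_ l) := wU; rewrite !mxE => wUl.
rewrite (_ : \sum_(j < _) _ = 0) ?rmorph0 ?mul0r // -[RHS]wUl.
by apply: eq_bigr => j _; rewrite mxE.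
Qed.

Lemma kfree_nil : kfree [::].
Proof. by move=> c _ []. Qed.

Lemma kfree_rcons u x : kfree u -> ~ in_kspan u x -> kfree (rcons u x).
Proof.
move=> /kfreeP fu hx; apply/kfreeP => c.
rewrite size_rcons big_ord_recr /= nth_rcons ltnn eqxx.
under eq_bigr => i _ do rewrite nth_rcons ltn_ord.
case: (eqVneq (c (size u)) 0) => [cu0|cu0] hs i.
  rewrite ltnS leq_eqVlt => /orP[/eqP->//|]; apply: fu.
  by rewrite cu0 rmorph0 mul0r addr0 in hs.
case: hx; apply/kspanP; exists (fun i => - (c i / c (size u))).
apply: (@mulfI _ (iota (c (size u)))); first by rewrite fmorph_eq0.
move/eqP: hs; rewrite addrC addr_eq0 => /eqP->.
rewrite mulr_sumr -sumrN; apply: eq_bigr => j _.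
by rewrite mulrA -rmorphM /= mulrN mulrCA divff // mulr1 rmorphN mulNr.
Qed.

Lemma kfree_extend u b : kfree u ->
  exists w, [/\ subseq w b, kfree (u ++ w)
    & forall x, x \in b -> in_kspan (u ++ w) x].
Proof.
elim/last_ind: b => [|b x IHb] fu; first by exists [::]; rewrite cats0; split.
have [w [wb fw hw]] := IHb fu.
case: (pselect (in_kspan (u ++ w) x)) => [hx|hx].
  exists w; split=> // [|y]; first exact: subseq_trans wb (subseq_rcons _ _).
  by rewrite mem_rcons inE => /predU1P[->|/hw].
exists (rcons w x); rewrite -rcons_cat; split.
- by rewrite -!cats1 cat_subseq.
- exact: kfree_rcons.
- move=> y; rewrite mem_rcons inE => /predU1P[->|/hw].
    by apply: kspan_mem; rewrite mem_rcons mem_head.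
  by apply: kspan_sub => z zu; rewrite mem_rcons inE zu orbT.
Qed.

Lemma kfree_uniq u : kfree u -> uniq u.
Proof.
move=> /kfreeP fu; apply/(uniqP 0) => i j; rewrite !inE => iu ju eq_ij.
apply/eqP/negPn/negP => ne_ij.
have := fu (fun l => (l == i)%:R - (l == j)%:R).
rewrite (_ : \sum_(l < _) _ = 0) => [/(_ erefl i iu)/eqP|].
  by rewrite eqxx (negPf ne_ij) subr0 oner_eq0.
rewrite (bigD1 (Ordinal iu)) // (bigD1 (Ordinal ju)) /=; last by rewrite -val_eqE eq_sym.
rewrite !eqxx (negPf ne_ij) eq_sym (negPf ne_ij) big1 => [|l /andP[]].
  by rewrite subr0 sub0r rmorph1 rmorphN1 eq_ij mulN1r mul1r addr0 subrr.
by rewrite -!val_eqE /= => /negPf-> /negPf->; rewrite subrr rmorph0 mul0r.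
Qed.

(** A basis extracted from [w] must already have as many elements as [u], hence is all of [w]. This
    transfers freeness between two enumerations of the same family. *)
Lemma kfree_of_size u w : kfree u -> (forall x, x \in u -> in_kspan w x) ->
  (size w <= size u)%N -> kfree w.
Proof.
move=> fu uw le_wu; have [v [vw fv hv]] := kfree_extend w kfree_nil.
rewrite cat0s in fv hv.
have le_uv : (size u <= size v)%N.
  by apply: kspan_size fu _ => x /uw; exact: kspan_trans.
have /eqP <- // : v == w.
by rewrite -(size_subseq_leqif vw) eqn_leq size_subseq //= (leq_trans le_wu).
Qed.

Lemma kfree_map_enum (I : finType) (f : I -> K) :
  (forall c : I -> k, \sum_i iota (c i) * f i = 0 -> forall i, c i = 0) ->
  kfree [seq f i | i <- enum I].
Proof.
move=> ff; apply/kfreeP => c; rewrite size_map => hs i iI.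
have [x0 _] : exists x0 : I, true by case: (enum I) iI => // x s _; exists x.
have h : \sum_(x : I) iota (c (index x (enum I))) * f x = 0.
  rewrite -[RHS]hs -big_enum /= (big_nth x0) big_mkord; apply: eq_bigr => j _.
  by rewrite index_uniq ?enum_uniq // (nth_map x0).
by rewrite -(ff _ h (nth x0 (enum I) i)) index_uniq ?enum_uniq.
Qed.

Lemma kdim_basis b : exists u, [/\ {subset u <= b}, kfree u,
  forall x, x \in b -> in_kspan u x & kdim iota b = size u].
Proof.
have [u [/mem_subseq ub fu hu]] := kfree_extend b kfree_nil; rewrite cat0s in fu hu.
exists u; split=> //; apply/eqP; rewrite eqn_leq; apply/andP; split.
  apply/bigmax_leqP => I /asboolP fI.
  have : (size [seq b`_(val i) | i <- enum I]%R <= size u)%N.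
    apply: kspan_size fI _ => x /mapP[i _ ->]; apply: hu; apply: mem_nth; exact: ltn_ord.
  by rewrite size_map -cardE.
(* The list [b] may repeat elements; keeping only first occurrences makes [J] as large as [u]. *)
pose J := [set i : 'I_(size b) | (b`_i \in u) && (index b`_i b == i)].
have sJ : perm_eq [seq b`_(val i) | i <- enum J] u.
  apply: uniq_perm; [|exact: kfree_uniq|].
    rewrite map_inj_in_uniq ?enum_uniq // => i j; rewrite !mem_enum !inE.
    move=> /andP[_ /eqP hi] /andP[_ /eqP hj] eq_ij; apply: val_inj => /=.
    by rewrite -hi -hj eq_ij.
  move=> x; apply/mapP/idP => [[i + ->]|xu].
    by rewrite mem_enum inE => /andP[].
  have xb : (index x b < size b)%N by rewrite index_mem ub.
  by exists (Ordinal xb); rewrite ?mem_enum ?inE /= nth_index ?ub // xu eqxx.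
have -> : size u = #|J| by rewrite -(perm_size sJ) size_map -cardE.
apply: (@leq_bigmax_cond _ _ (fun I : {set 'I_(size b)} => #|I|) J).
apply/asboolP.
apply: (kfree_of_size fu) => [x xu|]; last by rewrite (perm_size sJ).
by apply: kspan_mem; rewrite (perm_mem sJ).
Qed.

End KSpan.

(** * Consequences of Riemann-Roch *)

Section RiemannRoch.
Variables (k : closedFieldType) (K : fieldType) (iota : {rmorphism k -> K}).
Implicit Types (p q : place iota) (s : seq (place iota)) (D : place iota -> int).

Lemma fsum_supported (F : place iota -> int) s : uniq s ->
  (forall p, p \notin s -> F p = 0) ->
  \sum_(p \in [set: place iota]%classic) F p = \sum_(p <- s) F p.
Proof. move=> us Fs; rewrite (fsbigE s) // => [|p /= _ /Fs //].
by apply: eq_bigl => p; rewrite in_setT. Qed.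

Lemma divisor_supported D s : (forall p, p \notin s -> D p = 0) -> is_divisor D.
Proof.
move=> Ds; rewrite /is_divisor; apply: (@sub_finite_set _ _ [set` s]%classic) => //.
by move=> p /=; apply: contraNT => /Ds->.
Qed.

Lemma sum_pvalV s (x : K) : \sum_(p <- s) p x^-1 = - \sum_(p <- s) p x.
Proof. by rewrite -sumrN; apply: eq_bigr => p _; rewrite pvalV. Qed.

Lemma sum_delta s q (a : int) : uniq s -> q \in s ->
  \sum_(p <- s) (if p == q then a else 0) = a.
Proof.
by move=> us qs; rewrite (bigD1_seq q) //= eqxx big1 ?addr0 // => p /negPf->.
Qed.

Variables (gen : nat) (Hgen : is_genus iota gen).

(** The divisors D and D - q both lie in the range where the dimension is known, and the dimensions
    differ by one; a function in L(D) outside L(D - q) attains the allowed order at [q]. *)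
Lemma RR_exact D s q : uniq s -> (forall p, p \notin s -> D p = 0) -> q \in s ->
  2 * gen%:Z <= \sum_(p <- s) D p ->
  exists f, [/\ f != 0, q f = - D q & forall p, - D p <= p f].
Proof.
move=> us Ds qs degD.
pose D' p := D p - (if p == q then 1 else 0).
have D's p : p \notin s -> D' p = 0.
  move=> ps; rewrite /D' Ds //; case: eqP ps => [->|_ _]; first by rewrite qs.
  by rewrite subr0.
have degD' : deg D' = \sum_(p <- s) D p - 1.
  rewrite /deg (fsum_supported us D's) /D' big_split /= sumrN; congr (_ - _).
  exact: sum_delta.
have dD : deg D = \sum_(p <- s) D p by rewrite /deg (fsum_supported us Ds).
have [||b [bD fb _ sb]] := Hgen (D := D).
- exact: divisor_supported Ds.
- by rewrite dD; lia.
have [||b' [_ _ spb' sb']] := Hgen (D := D').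
- exact: divisor_supported D's.
- by rewrite degD'; lia.
have : ~ (forall x, x \in b -> inL D' x).
  move=> h; have : (size b <= size b')%N.
    by apply: kspan_size fb _ => x /h/spb'.
  by rewrite -lez_nat sb sb' dD degD'; lia.
move=> /existsNP[x /not_implyP[xb /not_orP[/eqP x0 xD']]].
have xD p : - D p <= p x.
  by have /allP/(_ x xb)/asboolP[/eqP|//] := bD; rewrite (negPf x0).
exists x; split=> //; apply/eqP; rewrite eq_le xD andbT leNgt; apply/negP => lt_x.
apply: xD' => p; rewrite /D'; case: eqP => [->|_]; last by rewrite subr0.
by rewrite opprB addrC lezD1.
Qed.

(** Multiplication by [y] maps L(D + (y)) into L(D), so comparing dimensions in large degree forbids
    (y) to have positive degree. The inverse gives the other sign. *)
Lemma sum_pval_eq0 (x : K) s : x != 0 -> uniq s ->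
  (forall p, p \notin s -> p x = 0) -> \sum_(p <- s) p x = 0.
Proof.
suff h (y : K) : y != 0 -> uniq s -> (forall p, p \notin s -> p y = 0) ->
    \sum_(p <- s) p y <= 0.
  move=> x0 us xs; apply/eqP; rewrite eq_le h //= -oppr_le0 -sum_pvalV.
  by rewrite h ?invr_eq0 // => p /xs px; rewrite pvalV px oppr0.
move=> y0 us ys; rewrite leNgt; apply/negP => sum_gt0.
have [q qs] : exists q, q \in s.
  by case: (s) sum_gt0 => [|q s' _]; [rewrite big_nil | exists q; rewrite mem_head].
pose D p : int := if p == q then 2 * gen%:Z else 0.
pose D' p := D p + p y.
have Ds p : p \notin s -> D p = 0 by rewrite /D; case: eqP => [->|//]; rewrite qs.
have D's p : p \notin s -> D' p = 0 by move=> ps; rewrite /D' Ds // ys.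
have degD : deg D = 2 * gen%:Z by rewrite /deg (fsum_supported us Ds) sum_delta.
have degD' : deg D' = 2 * gen%:Z + \sum_(p <- s) p y.
  by rewrite /deg (fsum_supported us D's) big_split /= sum_delta.
have [||b [_ _ spb sb]] := Hgen (D := D).
- exact: divisor_supported Ds.
- by rewrite degD; lia.
have [||b' [bD' fb' _ sb']] := Hgen (D := D').
- exact: divisor_supported D's.
- by rewrite degD'; lia.
have : (size b' <= size [seq y^-1 * z | z <- b]%R)%N.
  apply: kspan_size fb' _ => z zb'.
  have -> : z = y^-1 * (y * z) by rewrite mulKf.
  apply: kspan_mull; apply: spb.
  have /allP/(_ z zb')/asboolP[->|zD'] := bD'; first by left; rewrite mulr0.
  case: (eqVneq z 0) => [->|z0]; first by left; rewrite mulr0.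
  by right=> p; have := zD' p; rewrite pvalM // /D'; lia.
by rewrite size_map -lez_nat sb sb' degD degD'; lia.
Qed.

End RiemannRoch.

(** * Elements of k(t) *)

Section Evaluation.
Variables (k : closedFieldType) (K : fieldType) (iota : {rmorphism k -> K}).
Implicit Types (p : place iota) (x t : K) (a : {poly k}).

Definition ev t a : K := (map_poly iota a).[t].

Fact ev_is_zmod t : zmod_morphism (ev t).
Proof. by move=> a b; rewrite /ev rmorphB /= hornerD hornerN. Qed.
Fact ev_is_monoid t : monoid_morphism (ev t).
Proof. by split=> [|a b]; rewrite /ev ?rmorph1 ?hornerC // rmorphM hornerM. Qed.
HB.instance Definition _ t := GRing.isZmodMorphism.Build {poly k} K (ev t) (ev_is_zmod t).
HB.instance Definition _ t := GRing.isMonoidMorphism.Build {poly k} K (ev t) (ev_is_monoid t).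

Lemma evX t : ev t 'X = t.
Proof. by rewrite /ev map_polyX hornerX. Qed.

Lemma evC t c : ev t c%:P = iota c.
Proof. by rewrite /ev map_polyC hornerC. Qed.

Lemma evE t a : ev t a = \sum_(i < size a) iota a`_i * t ^+ i.
Proof.
rewrite /ev horner_coef size_map_poly; apply: eq_bigr => i _.
by rewrite coef_map.
Qed.

Lemma gev_ev p t a : gev p 0 t -> gev p 0 (ev t a).
Proof.
move=> ht; rewrite evE; apply: gev_sum => i _; apply: gevZ.
by rewrite -[0](mul0rn _ i) gevX.
Qed.

Lemma gev_ev0 p t a : gev p 1 t -> gev p 1 (ev t a - iota a.[0]).
Proof.
move=> ht; have : root (a - a.[0]%:P) 0 by rewrite /root hornerD hornerN hornerC subrr.
rewrite -(evC t) -rmorphB /= => /factor_theorem[b ->].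
rewrite subr0 rmorphM /= evX; apply: gevMl => //; apply: gev_ev.
exact: gevW ht.
Qed.

Lemma pval_iota_add p y c : c != 0 -> gev p 1 (y - iota c) -> y != 0 /\ p y = 0.
Proof.
move=> c0; have := @pvalDl _ _ _ p (iota c) (y - iota c).
by rewrite fmorph_eq0 pvalC add0r [iota c + _]addrC subrK => /(_ c0).
Qed.

(** Over the algebraically closed field [k], [a] splits; if no linear factor [t - iota z] vanished
    at [p], their product would be a unit there. *)
Lemma ev_root p t a : a != 0 -> gev p 0 t -> gev p 1 (ev t a) ->
  exists z, root a z /\ gev p 1 (t - iota z).
Proof.
move=> a0 ht; have [r ar] := closed_field_poly_normal a.
have ra z : root a z = (z \in r).
  by rewrite ar rootZ ?lead_coef_eq0 // root_prod_XsubC.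
apply: contraPP => /forallNP h.
have evz z : ev t ('X - z%:P) = t - iota z by rewrite rmorphB /= evX evC.
have pz z : z \in r -> ev t ('X - z%:P) != 0 /\ p (ev t ('X - z%:P)) = 0.
  move=> zr; have : ~ gev p 1 (t - iota z) by move=> hz; case: (h z); rewrite ra.
  move=> /negP; rewrite evz negb_or => /andP[tz0 lt1]; split=> //.
  have : gev p 0 (t - iota z) by rewrite gevB ?gevC.
  by rewrite gevE //; lia.
have l0 : iota (lead_coef a) != 0 by rewrite fmorph_eq0 lead_coef_eq0.
have p0 : \prod_(z <- r) ev t ('X - z%:P) != 0.
  by rewrite prodf_seq_neq0; apply/allP => z /pz[].
rewrite ar -mul_polyC rmorphM rmorph_prod /= evC; apply/negP.
rewrite gevE ?mulf_neq0 // pvalM // pvalC big_seq pval_prod => [|z /pz[]//].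
by rewrite big1 // => z /pz[].
Qed.

(** The degree of K over k(t) is at most [m], stated with denominators cleared so that it passes
    easily to [t - iota c] and to the inverse of [t]. *)
Definition alg_dim t m := forall x : 'I_m.+1 -> K,
  exists a : 'I_m.+1 -> {poly k}, (exists i, a i != 0) /\ \sum_i ev t (a i) * x i = 0.

Lemma alg_dim_shift t m c : alg_dim t m -> alg_dim (t - iota c) m.
Proof.
move=> ht x; have [a [[i ai0] ha]] := ht x.
exists (fun i => a i \Po ('X + c%:P)); split.
  exists i; have := size_comp_poly2 (a i) (q := 'X + c%:P).
  rewrite size_XaddC => /(_ erefl) sa.
  by rewrite -size_poly_eq0 sa size_poly_eq0.
rewrite -[RHS]ha; apply: eq_bigr => j _; congr (_ * _).
by rewrite /ev map_comp_poly horner_comp rmorphD /= map_polyX map_polyC /= hornerD hornerX hornerC subrK.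
Qed.

Lemma alg_dim_inv t m : t != 0 -> alg_dim t m -> alg_dim t^-1 m.
Proof.
move=> t0 ht x; have [a [[i ai0] ha]] := ht x.
pose e := \max_j size (a j).
have le_e j : (size (a j) <= e)%N by exact: (@leq_bigmax _ (fun j => size (a j))).
(* Reversal of all coefficients in the common length [e]: the value at the inverse of [t] is that of
   [a j] at [t] divided by [t ^+ e.-1]. *)
pose b j := \poly_(l < e) (a j)`_(e.-1 - l).
have e_gt0 : (0 < e)%N by rewrite (leq_trans _ (le_e i)) // size_poly_gt0.
exists b; split.
  exists i; apply: contra_neq ai0 => bi0; apply/polyP => l; rewrite coef0.
  have [le_l|lt_l] := leqP e l; first by rewrite nth_default // (leq_trans (le_e i)).
  have /polyP/(_ (e.-1 - l)%N) := bi0; rewrite coef_poly coef0 subKn; last by rewrite -ltnS prednK.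
  by rewrite (leq_ltn_trans (leq_subr _ _)) // prednK.
have evb j : ev t^-1 (b j) = t ^- e.-1 * ev t (a j).
  rewrite /ev (@horner_coef_wide _ e (map_poly iota (a j))) ?size_map_poly //.
  rewrite (@horner_coef_wide _ e) ?size_map_poly ?size_poly //.
  rewrite mulr_sumr (reindex_inj rev_ord_inj) /=; apply: eq_bigr => l _.
  rewrite !coef_map coef_poly /= (_ : (e - l.+1 < e)%N); last by rewrite ltn_subrL.
  have -> : (e.-1 - (e - l.+1))%N = l by have := ltn_ord l; lia.
  rewrite mulrCA; congr (_ * _); apply: (@mulfI _ (t ^+ e.-1)); first by rewrite expf_neq0.
  rewrite mulrA divff ?expf_neq0 // mul1r exprVn.
  have -> : e.-1 = (l + (e - l.+1))%N by have := ltn_ord l; lia.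
  by rewrite exprD mulfK // expf_neq0.
under eq_bigr => j _ do rewrite evb -mulrA.
by rewrite -mulr_sumr ha mulr0.
Qed.

(** Dividing a relation by the largest common power of [t] leaves one that stays nontrivial after
    reduction modulo [t], which is how it is used at a zero of [t]. *)
Lemma alg_dim_norm t m : t != 0 -> alg_dim t m -> forall x : 'I_m.+1 -> K,
  exists a : 'I_m.+1 -> {poly k}, (exists i, (a i).[0] != 0) /\ \sum_i ev t (a i) * x i = 0.
Proof.
move=> t0 ht x; have [a [[i +] +]] := ht x.
have [e] := ubnP (size (a i)); elim: e a => // e IHe a lt_e ai0 ha.
have [h|/existsNP[j /negP aj0]] := pselect (forall j, (a j).[0] == 0); last first.
  by exists a; split=> //; exists j.
have /choice[b hb] : forall j, exists b, a j = b * 'X.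
  by move=> j; have /factor_theorem[b ->] := h j; exists b; rewrite subr0.
have bi0 : b i != 0 by apply: contra_neq ai0; rewrite hb => ->; rewrite mul0r.
apply: (IHe b) => //.
  by move: lt_e; rewrite hb size_mulX.
apply: (mulfI t0); rewrite mulr0 mulr_sumr -[RHS]ha; apply: eq_bigr => j _.
by rewrite hb rmorphM /= evX mulrA [t * _]mulrC.
Qed.

Lemma alg_dim_exists t (b : seq K) :
  (forall x, exists r : 'I_(size b) -> K, (forall i, in_kt iota t (r i)) /\
      x = \sum_(i < size b) r i * b`_i) -> alg_dim t (size b).
Proof.
move=> hb x; set m := size b.
have /choice[r hr] : forall j : 'I_m.+1, exists r : 'I_m -> {poly k} * {poly k},
    (forall i, ev t (r i).2 != 0) /\ x j = \sum_(i < m) ev t (r i).1 / ev t (r i).2 * b`_i.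
  move=> j; have [r [rkt ->]] := hb (x j).
  have /choice[pq hpq] : forall i, exists pq : {poly k} * {poly k}, ev t pq.2 != 0 /\ r i = ev t pq.1 / ev t pq.2.
    by move=> i; have [P [Q [Q0 ->]]] := rkt i; exists (P, Q).
  exists pq; split=> [i|]; first by case: (hpq i).
  by apply: eq_bigr => i _; case: (hpq i) => _ ->.
pose Q j := \prod_i (r j i).2.
pose P j i := (r j i).1 * \prod_(l | l != i) (r j l).2.
have hP j : ev t (Q j) * x j = \sum_i ev t (P j i) * b`_i.
  case: (hr j) => r0 ->; rewrite mulr_sumr; apply: eq_bigr => i _.
  rewrite /Q (bigD1 i) //= /P !rmorphM /=; have := r0 i; set y := ev t (r j i).2 => y0.
  set z := ev t (\prod_(l | l != i) _).
  by rewrite mulrA; congr (_ * _); field.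
have Q0 j : Q j != 0.
  apply/prodf_neq0 => i _; case: (hr j) => /(_ i) + _.
  by apply: contra_neq => ->; rewrite rmorph0.
(* A zero column makes the coordinate matrix square, hence singular; a left kernel vector is the
   relation sought. *)
pose M := \matrix_(j < m.+1, i < m.+1) (if unlift ord_max i is Some i' then P j i' else 0).
have /eqP/det0P[v v0 vM] : \det M = 0.
  rewrite (expand_det_col _ ord_max) big1 // => j _.
  by rewrite mxE unlift_none mul0r.
exists (fun j => v 0 j * Q j); split.
  have /rV0Pn[j vj0] := v0; exists j; by rewrite mulf_neq0.
under eq_bigr => j _ do rewrite rmorphM /= -mulrA hP mulr_sumr.
rewrite exchange_big big1 //= => i _.
under eq_bigr => j _ do rewrite mulrA -rmorphM.
rewrite -mulr_suml -rmorph_sum /=.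
have /rowP/(_ (lift ord_max i)) := vM; rewrite !mxE => vMi.
rewrite (_ : \sum_(j < _) _ = 0) ?rmorph0 ?mul0r // -[RHS]vMi.
by apply: eq_bigr => j _; rewrite mxE liftK.
Qed.

End Evaluation.

(** * Finiteness of supports and residue fields *)

Lemma bounded_enum (T : eqType) (P : T -> Prop) m :
  (forall s : seq T, uniq s -> (forall x, x \in s -> P x) -> (size s <= m)%N) ->
  exists s : seq T, forall x, P x -> x \in s.
Proof.
elim: m P => [|m IHm] P hP.
  exists [::] => x Px; have := hP [:: x] isT.
  by rewrite /= => /(_ (fun y => ltac:(by rewrite inE => /eqP->))).
have [[x Px]|/forallNP nP] := pselect (exists x, P x); last by exists [::] => x /nP.
have [s us|s hs] := IHm (fun y => P y /\ y != x).
  move=> sP; have := hP (x :: s); rewrite /= us andbT; apply.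
    by apply/negP => /sP[_]; rewrite eqxx.
  by move=> y; rewrite inE => /predU1P[->//|/sP[]].
exists (x :: s) => y Py; rewrite inE; case: eqVneq => //= yx; exact: hs.
Qed.

Section FiniteSupport.
Variables (k : closedFieldType) (K : fieldType) (iota : {rmorphism k -> K}).
Implicit Types (p q : place iota) (s : seq (place iota)).
Variables (gen : nat) (Hgen : is_genus iota gen) (HK : is_function_field iota).

Local Notation ev := (ev iota).

(* Riemann-Roch provides y_0, ..., y_m such that y_l has the smallest order at the l-th zero;
   a k(t)-linear relation among them is impossible there. *)
Lemma zeros_bounded (t : K) m s : t != 0 -> alg_dim iota t m -> uniq s ->
  (forall p, p \in s -> gev p 1 t) -> (size s <= m)%N.
Proof.
move=> t0 ht us hs; rewrite leqNgt; apply/negP => lt_ms.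
have [p0 p0s] : exists p0, p0 \in s by case: (s) lt_ms => // p0 s' _; exists p0; rewrite mem_head.
pose N : int := 2 * gen%:Z + (size s)%:Z.
(* The target order -N at the single point [p0] only serves to raise the degree of the divisors
   below to 2 gen + 1, within reach of [RR_exact]. *)
pose o p : int := if p == p0 then - N else 0.
have hy p : p \in s -> exists y, [/\ y != 0, p y = o p &
    forall p', p' \in s -> p' != p -> o p' + 1 <= p' y].
  move=> ps; pose D p' : int := if p' \in s then - o p' + (if p' == p then 1 else 0) - 1 else 0.
  have Ds p' : p' \notin s -> D p' = 0 by rewrite /D => /negPf->.
  have degD : \sum_(p' <- s) D p' = 2 * gen%:Z + 1.
    have -> : \sum_(p' <- s) D p' = \sum_(p' <- s) (- o p' + (if p' == p then 1 else 0) - 1).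
      by apply: eq_big_seq => p' p's; rewrite /D p's.
    rewrite !big_split /= sum_delta //.
    have -> : \sum_(p' <- s) - o p' = N.
      rewrite -[RHS](sum_delta N us p0s); apply: eq_bigr => p' _.
      by rewrite /o; case: ifP; rewrite ?opprK ?oppr0.
    have -> : \sum_(p' <- s) (-1 : int) = - (size s)%:Z.
      by rewrite big_const_seq count_predT iter_addr addr0 mulNrn natz.
    by rewrite /N; lia.
  have [|y [y0 py yD]] := RR_exact Hgen (q := p) us Ds ps; first by rewrite degD; lia.
  exists y; split=> //; first by rewrite py /D ps eqxx; lia.
  by move=> p' p's p'p; have := yD p'; rewrite /D p's (negPf p'p); lia.
pose pl (i : 'I_m.+1) := nth p0 s i.
have pls i : pl i \in s by apply: mem_nth; exact: leq_trans (ltn_ord i) lt_ms.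
have pl_inj i j : i != j -> pl i != pl j.
  by move=> ij; rewrite nth_uniq ?(leq_trans (ltn_ord _) lt_ms).
have /choice[y yP] := fun i => hy _ (pls i).
have [a [[l al0] ha]] := alg_dim_norm t0 ht y.
have [yl0 plyl _] := yP l.
have [el0 pel] := pval_iota_add al0 (gev_ev0 (a l) (hs _ (pls l))).
have [|i il|] := @pval_sum_dominant _ _ _ (pl l) _ (fun i => ev t (a i) * y i) l.
- by rewrite mulf_neq0.
- rewrite pvalM // pel add0r plyl; apply: gevMl.
  by apply: gev_ev; apply: gevW (hs _ (pls l)).
  by have [yi0 _ hyi] := yP i; rewrite gevE // hyi // pl_inj // eq_sym.
- by rewrite ha eqxx.
Qed.

Lemma zeros_finite (t : K) m : t != 0 -> alg_dim iota t m ->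
  exists s, forall p, gev p 1 t -> p \in s.
Proof. by move=> t0 ht; apply: (@bounded_enum _ _ m) => s; exact: zeros_bounded. Qed.

Lemma alg_dim_powers (t x : K) m : alg_dim iota t m ->
  exists a : 'I_m.+1 -> {poly k}, (exists i, a i != 0) /\ \sum_i ev t (a i) * x ^+ i = 0.
Proof. by move=> /(_ (fun i => x ^+ i)). Qed.

Lemma ktrans_ev (t : K) a : ktrans iota t -> a != 0 -> ev t a != 0.
Proof. by move=> tr; apply: contra_neq => /tr. Qed.

Lemma ktrans_sub_neq0 (t : K) c : ktrans iota t -> t - iota c != 0.
Proof.
move=> tr; have := ktrans_ev tr (negbT (polyXsubC_eq0 c)).
by rewrite rmorphB /= evX evC.
Qed.

(** The element [x] satisfies an algebraic equation over k[t]. A pole of [x] is a pole of [t] or a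
    zero of the leading coefficient, since otherwise the leading term would dominate; both kinds lie
    among the zeros of the inverse of [t] and of finitely many [t - iota c]. *)
Lemma poles_finite (x : K) : exists s, forall p, ~~ gev p 0 x -> p \in s.
Proof.
have [t [tr [b hb]]] := HK; have ht := alg_dim_exists hb; set m := size b in ht.
have t0 : t != 0 by have := ktrans_sub_neq0 0 tr; rewrite rmorph0 subr0.
have [s0 hs0] : exists s, forall p, gev p 1 t^-1 -> p \in s.
  by apply: (@zeros_finite _ m); [rewrite invr_eq0|exact: alg_dim_inv].
have [a [a_neq0 ha]] := alg_dim_powers x ht.
have [l al0 lmax] : exists2 l, a l != 0 & forall i : 'I_m.+1, (l < i)%N -> a i = 0.
  have [i ai0] := a_neq0; have [l al0 lmax] := @arg_maxnP _ i (fun i => a i != 0) val ai0.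
  exists l => // j lj; apply/eqP/negPn/negP => /lmax /=; by rewrite leqNgt lj.
have [r ar] := closed_field_poly_normal (a l).
have /choice[sz hsz] : forall c, exists s, forall p, gev p 1 (t - iota c) -> p \in s.
  move=> c; apply: (@zeros_finite _ m); first exact: ktrans_sub_neq0.
  exact: alg_dim_shift.
exists (s0 ++ flatten [seq sz c | c <- r]) => p hx; rewrite mem_cat.
have [/hs0->//|ht1] := boolP (gev p 1 t^-1).
have pt : gev p 0 t.
  by move: ht1; rewrite !gevE ?invr_eq0 // pvalV; lia.
have /norP[x0 px] := hx.
have eal0 := ktrans_ev tr al0.
have : gev p 1 (ev t (a l)).
  apply/negPn/negP; rewrite gevE // => lt1.
  have pal : p (ev t (a l)) = 0 by have := gev_ev (a l) pt; rewrite gevE //; lia.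
  have [|i il|] := @pval_sum_dominant _ _ _ p _ (fun i => ev t (a i) * x ^+ i) l;
    [by rewrite mulf_neq0 ?expf_neq0| |by rewrite ha eqxx].
  rewrite pvalM ?expf_neq0 // pal add0r pvalX.
  have [lt_li|le_il] := ltnP l i; first by rewrite lmax // rmorph0 mul0r gev0.
  apply: gevMl; first exact: gev_ev.
  rewrite gevE ?expf_neq0 // pvalX.
  have : (i < l)%N by rewrite ltn_neqAle il.
  move: px; rewrite -ltNge; set e := p x => e0 lt_il.
  by rewrite -(subnKC (ltnW lt_il)) mulrnDr lezD1 gtrDl pmulrn_llt0 ?subn_gt0.
case/(ev_root al0 pt) => z; rewrite ar rootZ ?lead_coef_eq0 // root_prod_XsubC.
case=> zr /hsz pz; apply/orP; right; apply/flatten_mapP; by exists z.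
Qed.

Lemma pval_support (x : K) : exists s, uniq s /\ forall p, p \notin s -> p x = 0.
Proof.
have [s hs] := poles_finite x; have [s' hs'] := poles_finite x^-1.
exists (undup (s ++ s')); split; first exact: undup_uniq.
move=> p; rewrite mem_undup mem_cat negb_or => /andP[ps ps'].
have [->|x0] := eqVneq x 0; first exact: pval0.
have := contraNT (hs p) ps; have := contraNT (hs' p) ps'.
by rewrite !gevE ?invr_eq0 // pvalV; lia.
Qed.

(** The residue field is [k]: with [tau] vanishing at [p], an equation for [x] over k[tau] reduces
    modulo [tau] to a nonzero polynomial [Q] over [k] such that Q(x) vanishes at [p], and a root of
    [Q] is the residue. *)
Lemma residue p (x : K) : gev p 0 x -> exists c, gev p 1 (x - iota c).
Proof.
move=> hx; have [t [tr [b hb]]] := HK; have ht := alg_dim_exists hb; set m := size b in ht.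
have t0 : t != 0 by have := ktrans_sub_neq0 0 tr; rewrite rmorph0 subr0.
have [tau [tau0 ptau htau]] : exists tau, [/\ tau != 0, gev p 1 tau & alg_dim iota tau m].
  have [ht1|ht1] := boolP (gev p 1 t^-1).
    by exists t^-1; split; rewrite ?invr_eq0 //; exact: alg_dim_inv.
  have pt : gev p 0 t by move: ht1; rewrite !gevE ?invr_eq0 // pvalV; lia.
  suff [a a0 pa] : exists2 a, a != 0 & gev p 1 (ev t a).
    have [z [_ hz]] := ev_root a0 pt pa; exists (t - iota z); split=> //.
      exact: ktrans_sub_neq0.
    exact: alg_dim_shift.
  (* Otherwise every nonzero polynomial in [t] is a unit at [p]; the terms of a relation among
     powers of a uniformizer then have distinct orders, so the relation is trivial. *)
  apply: contrapT => /forall2NP h.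
  have pev a : a != 0 -> p (ev t a) = 0.
    move=> a0; have [//|/negP] := h a; rewrite gevE ?ktrans_ev //.
    by have := gev_ev a pt; rewrite gevE ?ktrans_ev //; lia.
  have [_ _ _ _ [u pu]] := pvalP p.
  have u0 : u != 0 by apply: contra_eq_neq pu => ->; rewrite pval0.
  have [a [[i /negP ai0] ha]] := alg_dim_powers u ht; apply: ai0; apply/eqP/tr.
  have hneq j : ev t (a j) * u ^+ j != 0 -> p (ev t (a j) * u ^+ j) = j :> int.
    rewrite mulf_eq0 negb_or => /andP[aj0 uj0]; rewrite pvalM // pvalX pu pev ?add0r ?natz //.
    by apply: contra_neq aj0 => ->; rewrite rmorph0.
  have := @gev_sum_distinct _ _ _ p _ (fun j => ev t (a j) * u ^+ j) (i%:Z + 1) _ _ i.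
  rewrite ha gev0 => h'.
  have {h'} := h' _ isT.
  rewrite /gev; have [/eqP + _|nz] := eqVneq (ev t (a i) * u ^+ i) 0.
    by rewrite mulf_eq0 expf_eq0 (negPf u0) andbF orbF => /eqP.
  rewrite hneq // => h'; suff : i%:Z + 1 <= i by lia.
  by apply: h' => j j' jj' /hneq-> /hneq->.
have [a [[i ai0] ha]] := alg_dim_norm tau0 htau (fun j => x ^+ j).
pose Q := \poly_(j < m.+1) (a (inord j)).[0].
have Q0 : Q != 0.
  apply: contra_neq ai0 => Q0; have /polyP/(_ i) := Q0.
  by rewrite coef0 coef_poly ltn_ord inord_val.
have QE : ev x Q = \sum_(j < m.+1) iota (a j).[0] * x ^+ j.
  rewrite /ev (@horner_coef_wide _ m.+1) ?size_map_poly ?size_poly //.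
  by apply: eq_bigr => j _; rewrite coef_map coef_poly ltn_ord inord_val.
have [|z [_ hz]] := ev_root (p := p) Q0 hx; last by exists z.
have -> : ev x Q = \sum_j (iota (a j).[0] - ev tau (a j)) * x ^+ j.
  by under [RHS]eq_bigr do rewrite mulrBl; rewrite sumrB ha subr0.
apply: gev_sum => j _; rewrite -[1]addr0; apply: gevM.
  by rewrite -gevN opprB gev_ev0.
by rewrite -[0](mul0rn _ j) gevX.
Qed.

End FiniteSupport.

(** * Functions regular away from one point *)

Lemma double_sum_ord n : (2 * \sum_(i < n) i = n * n.-1)%N.
Proof. by rewrite -(big_mkord xpredT id) /= bin2_sum -mul_bin_diag bin1. Qed.

Section AffineRing.
Variables (k : closedFieldType) (K : fieldType) (iota : {rmorphism k -> K}).
Implicit Types (p q : place iota) (x y z : K).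

Definition inA q x := forall p, p != q -> gev p 0 x.

Lemma inA0 q : inA q 0.
Proof. by move=> p _; exact: gev0. Qed.

Lemma inAC q c : inA q (iota c).
Proof. by move=> p _; exact: gevC. Qed.

Lemma inA1 q : inA q 1.
Proof. by rewrite -(rmorph1 iota); exact: inAC. Qed.

Lemma inAD q x y : inA q x -> inA q y -> inA q (x + y).
Proof. by move=> hx hy p pq; rewrite gevD ?hx ?hy. Qed.

Lemma inAB q x y : inA q x -> inA q y -> inA q (x - y).
Proof. by move=> hx hy p pq; rewrite gevB ?hx ?hy. Qed.

Lemma inAM q x y : inA q x -> inA q y -> inA q (x * y).
Proof. by move=> hx hy p pq; apply: gevMl; [exact: hx|exact: hy]. Qed.

Lemma inAX q x n : inA q x -> inA q (x ^+ n).
Proof. by move=> hx p pq; rewrite -[0](mul0rn _ n) gevX ?hx. Qed.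

Lemma inA_sum q (I : Type) (s : seq I) (P : pred I) (f : I -> K) :
  (forall i, P i -> inA q (f i)) -> inA q (\sum_(i <- s | P i) f i).
Proof. by move=> hf p pq; apply: gev_sum => i /hf; exact. Qed.

Lemma inA_ev q x a : inA q x -> inA q (ev iota x a).
Proof. by move=> hx p pq; apply: gev_ev; exact: hx. Qed.

Variables (gen : nat) (Hgen : is_genus iota gen) (HK : is_function_field iota).

Lemma inA_le0 q x : x != 0 -> inA q x -> q x <= 0.
Proof.
move=> x0 hx; have [s [us hs]] := pval_support Hgen HK x.
have [qs|/hs->//] := boolP (q \in s).
have := sum_pval_eq0 Hgen x0 us hs; rewrite (bigD1_seq q) //= => /eqP.
rewrite addr_eq0 => /eqP->; rewrite oppr_le0; apply: sumr_ge0 => p /hx.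
by rewrite gevE.
Qed.

Lemma inA_eq0 q x : inA q x -> gev q 1 x -> x = 0.
Proof.
move=> hx; apply: contraTeq => x0.
by have := inA_le0 x0 hx; rewrite gevE //; lia.
Qed.

Lemma residue_sub p x y : y != 0 -> gev p (p y) x ->
  exists c, gev p (p y + 1) (x - iota c * y).
Proof.
move=> y0 hx; have := @gevM _ _ _ p _ _ _ _ hx (gev_refl p y^-1).
rewrite pvalV subrr => /(residue HK)[c hc]; exists c.
by have := gevM hc (gev_refl p y); rewrite mulrBl divfK // addrC.
Qed.

(** Membership of [e] in the Weierstrass semigroup of [q]. *)
Definition nongap q (e : nat) := exists x, [/\ x != 0, inA q x & q x = - e%:Z].

Lemma nongap_ge q e : (2 * gen <= e)%N -> nongap q e.
Proof.
move=> le_e; pose D p : int := if p == q then e%:Z else 0.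
have [|||x [x0 xq xD]] := RR_exact Hgen (D := D) (s := [:: q]) (q := q) isT.
- by move=> p; rewrite inE /D => /negPf->.
- by rewrite inE.
- by rewrite big_seq1 /D eqxx; lia.
exists x; split=> //; last by rewrite xq /D eqxx.
by move=> p /negPf pq; have := xD p; rewrite /D pq oppr0 gevE.
Qed.

Lemma nongap_span q n (f : 'I_n -> K) :
  (forall i : 'I_n, nongap q i -> [/\ f i != 0, inA q (f i) & q (f i) = - (i : nat)%:Z]) ->
  forall x, inA q x -> gev q (1 - n%:Z) x ->
  in_kspan iota [seq f i | i <- enum [pred i : 'I_n | `[< nongap q i >]]] x.
Proof.
move=> hf x hx hn.
suff h m : forall x, inA q x -> gev q (1 - m%:Z) x -> (m <= n)%N ->
    in_kspan iota [seq f i | i <- enum [pred i : 'I_n | `[< nongap q i >]]] x by exact: (h n).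
elim: m => [|m IHm] {hn hx}x hx hm le_mn.
  by rewrite subr0 in hm; rewrite (inA_eq0 hx hm); exact: kspan0.
have [hm'|] := boolP (gev q (1 - m%:Z) x); first exact: IHm (ltnW le_mn).
rewrite negb_or => /andP[x0 lt_m].
have qx : q x = - m%:Z by move: hm; rewrite gevE //; lia.
have ng : nongap q (Ordinal le_mn) by exists x.
have [f0 fA qf] := hf _ ng.
have [|c hc] := @residue_sub q x (f (Ordinal le_mn)) f0; first by rewrite qf gevE // qx.
rewrite -(subrK (iota c * f (Ordinal le_mn)) x); apply: kspanD; last first.
  apply: kspanZ; apply: kspan_mem; apply/mapP; exists (Ordinal le_mn) => //.
  by rewrite mem_enum; apply/asboolP; exact: ng.
apply: IHm (ltnW le_mn); first by apply: inAB => //; apply: inAM => //; exact: inAC.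
by move: hc; rewrite qf addrC.
Qed.

(** The space L(2 gen q) has dimension gen + 1 and is spanned by one function for each pole order up
    to 2 gen, so at most gen of these orders are gaps. *)
Lemma count_nongap q :
  ((2 * gen).+1 <= gen + #|[pred i : 'I_(2 * gen).+1 | `[< nongap q i >]]|)%N.
Proof.
set n := (2 * gen).+1.
have /choice[f hf] : forall i : 'I_n, exists x,
    nongap q i -> [/\ x != 0, inA q x & q x = - (i : nat)%:Z].
  by move=> i; have [[x hx]|ng] := pselect (nongap q i); [exists x | exists 0 => /ng].
pose D p : int := if p == q then (2 * gen)%:Z else 0.
have Ds p : p \notin [:: q] -> D p = 0 by rewrite inE /D => /negPf->.
have degD : deg D = (2 * gen)%:Z.
  by rewrite /deg (fsum_supported (s := [:: q]) _ Ds) // big_seq1 /D eqxx.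
have [||b [bD fb _ sb]] := Hgen (D := D).
- exact: divisor_supported Ds.
- by rewrite degD; lia.
have /(kspan_size fb) : forall x, x \in b ->
    in_kspan iota [seq f i | i <- enum [pred i : 'I_n | `[< nongap q i >]]] x.
  move=> x xb; have /allP/(_ x xb)/asboolP xD := bD.
  apply: (nongap_span hf).
    case: xD => [->|xD]; first exact: inA0.
    by move=> p /negPf pq; have := xD p; rewrite /D pq oppr0 /gev => ->; rewrite orbT.
  case: xD => [->|xD]; first exact: gev0.
  by have := xD q; rewrite /D eqxx /gev /n => h; apply/orP; right; lia.
by rewrite size_map -cardE -lez_nat sb degD; move: #|_| => c; lia.
Qed.

(* For each residue class modulo n = 2 gen + 1 the basis contains an element of smallest
   pole order s i at q; gaps are below n, so s i is i or i + n. *)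
Lemma affine_basis q (n := (2 * gen).+1) :
  exists (t : K) (x : 'I_n -> K) (s : 'I_n -> nat),
  [/\ [/\ t != 0, inA q t & q t = - n%:Z],
      forall i, [/\ x i != 0, inA q (x i) & q (x i) = - (s i)%:Z],
      forall i, (s i %% n)%N = i,
      forall e (i : 'I_n), nongap q e -> (e %% n)%N = i -> (s i <= e)%N
    & (2 * \sum_i s i <= n * (n.-1 + 2 * gen))%N].
Proof.
have [t [t0 tA qt]] : nongap q n by apply: nongap_ge; rewrite /n.
pose s (i : 'I_n) : nat := if `[< nongap q i >] then i : nat else (i + n)%N.
have /choice[x hx] : forall i, nongap q (s i).
  move=> i; rewrite /s; case: asboolP => // _; apply: nongap_ge.
  by rewrite /n; lia.
exists t, x, s; split=> //.
- by move=> i; rewrite /s; case: asboolP => _; rewrite ?modnDr modn_small.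
- move=> e i ng_e ei; rewrite /s; case: asboolP => ng_i; first by rewrite -ei leq_mod.
  have [lt_en|le_ne] := ltnP e n; first by case: ng_i; rewrite -ei modn_small.
  have := divn_eq e n; rewrite ei; have : (0 < e %/ n)%N by rewrite divn_gt0.
  by nia.
(* Each gap adds [n] to the sum of the [s i], and there are at most gen gaps. *)
have sE i : s i = (i + n * ~~ `[< nongap q i >])%N by rewrite /s; case: asboolP => _ /=; lia.
rewrite (eq_bigr _ (fun i _ => sE i)) big_split /= mulnDr.
rewrite double_sum_ord.
rewrite mulnDr leq_add2l -big_distrr /= mulnCA leq_mul2l leq_mul2l.
have := count_nongap q; rewrite -/n => h.
have := cardC [pred i : 'I_n | `[< nongap q i >]]; rewrite card_ord.
suff -> : (\sum_(i < n) ~~ `[< nongap q i >] = #|predC [pred i : 'I_n | `[< nongap q i >]]|)%N.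
  by move: h; set c1 := #|_|; set c2 := #|_|; lia.
rewrite -sum1_card [RHS]big_mkcond; apply: eq_bigr => i _; rewrite !inE.
by case: asboolP.
Qed.

End AffineRing.

(** * The trace form and its discriminant *)

Lemma ler_sum_subset (T : eqType) (r r' : seq T) (F : T -> int) :
  uniq r -> uniq r' -> {subset r <= r'} -> (forall x, x \in r' -> 0 <= F x) ->
  \sum_(x <- r) F x <= \sum_(x <- r') F x.
Proof.
move=> ur ur' rr' F0; rewrite [leRHS](bigID (mem r)) /= -[X in _ <= X + _]big_filter.
have pr : perm_eq r [seq x <- r' | x \in r].
  apply: uniq_perm => // [|x]; first exact: filter_uniq.
  by rewrite mem_filter; case: (boolP (x \in r)) => // /rr'->.
rewrite (perm_big _ pr) /=.
by rewrite lerDl big_seq_cond sumr_ge0 // => x /andP[/F0].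
Qed.

Lemma nilpotent_trace (k : closedFieldType) n (A : 'M[k]_n.+1) N : A ^+ N = 0 -> \tr A = 0.
Proof.
move=> nilA; have [r] := closed_field_poly_normal (char_poly A).
rewrite (monicP (char_poly_monic A)) scale1r => cA.
have r0 z : z \in r -> z = 0.
  rewrite -root_prod_XsubC -cA -eigenvalue_root_char => /eigenvalueP[v vA v0].
  have : v *m A ^+ N = z ^+ N *: v.
    elim: N {nilA} => [|N IHN]; first by rewrite !expr0 mulmx1 scale1r.
    by rewrite exprSr mulmxA IHN -scalemxAl vA scalerA -exprSr.
  rewrite nilA mulmx0 => /esym/eqP; rewrite scaler_eq0 (negPf v0) orbF expf_eq0.
  by case/andP => _ /eqP.
have cX : char_poly A = 'X^(size r).
  rewrite cA big_seq (eq_bigr (fun=> 'X)) => [|z /r0->]; last by rewrite subr0.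
  by rewrite -big_seq big_const_seq count_predT iter_mulr_1.
have sr : size r = n.+1 by have := size_char_poly A; rewrite cX size_polyXn => -[].
apply/eqP; rewrite -oppr_eq0 -char_poly_trace // cX sr coefXn /=.
by rewrite ltn_eqF.
Qed.

Lemma dvdp_det_rows (F : fieldType) n (B : 'M[{poly F}]_n) (f : {poly F}) r :
  (forall i j : 'I_n, (r <= i)%N -> f %| B i j) -> f ^+ (n - r) %| \det B.
Proof.
move=> fB; pose d : 'rV_n := \row_i (if (r <= i)%N then f else 1).
pose B' := \matrix_(i, j) (if (r <= i)%N then B i j %/ f else B i j).
have -> : B = diag_mx d *m B'.
  apply/matrixP => i j; rewrite mul_diag_mx !mxE; case: ifP => [/(fB i j)|_].
    by move/divpK => {1}<-; rewrite mulrC.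
  by rewrite mul1r.
rewrite det_mulmx det_diag; apply: dvdp_mulr.
under eq_bigr => i _ do rewrite mxE.
by rewrite -big_mkcond -(big_geq_mkord _ _ xpredT (fun=> f)) prodr_const_nat.
Qed.

Section TraceForm.
Variables (k : closedFieldType) (K : fieldType) (iota : {rmorphism k -> K}).
Variables (gen : nat) (Hgen : is_genus iota gen) (HK : is_function_field iota).
Hypothesis char0 : [pchar k] =i pred0.
Variables (q : place iota) (n' : nat).
Local Notation n := n'.+1.
Variables (t : K) (x : 'I_n -> K) (s : 'I_n -> nat).
Hypotheses (t0 : t != 0) (tA : inA q t) (qt : q t = - n%:Z).
Hypotheses (x0 : forall i, x i != 0) (xA : forall i, inA q (x i)).
Hypotheses (qx : forall i, q (x i) = - (s i)%:Z) (s_mod : forall i, (s i %% n)%N = i).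
Hypothesis s_min : forall e (i : 'I_n), nongap q e -> (e %% n)%N = i -> (s i <= e)%N.

Local Notation ev := (ev iota t).
Implicit Types (p : place iota) (y z : K) (a b : 'rV[{poly k}]_n) (c : k) (f : {poly k}).

(** * Coordinates over k[t] of the functions regular off q *)

Lemma pval_ev f : f != 0 -> ev f != 0 /\ q (ev f) = - (n * (size f).-1)%:Z.
Proof.
move=> f0; have sf : ((size f).-1 < size f)%N by rewrite prednK // size_poly_gt0.
have lf : iota f`_(size f).-1 != 0 by rewrite fmorph_eq0 -lead_coefE lead_coef_eq0.
rewrite evE.
have qtn i : q (iota f`_(size f).-1 * t ^+ i) = - (n * i)%:Z.
  by rewrite pvalM ?expf_neq0 // pvalC add0r pvalX qt PoszM mulrn_int mulNr.
have [||-> ->] := @pval_sum_dominant _ _ _ q _ (fun i : 'I_(size f) => iota f`_i * t ^+ i) (Ordinal sf).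
- by rewrite /= mulf_neq0 ?expf_neq0.
- move=> i il; rewrite qtn; apply: gevZ; rewrite gevE ?expf_neq0 // pvalX qt.
  have : (i < (size f).-1)%N.
    by rewrite -val_eqE /= in il; rewrite ltn_neqAle il -ltnS prednK ?size_poly_gt0 // ltn_ord.
  by rewrite -(ltn_pmul2l (ltn0Sn n')) mulrn_int mulNr -PoszM => lt_i; rewrite lezD1 ltrN2 ltz_nat.
- by rewrite /= qtn.
Qed.

Lemma ev_inj : injective ev.
Proof.
move=> f g eq_fg; apply/eqP; rewrite -subr_eq0; apply/negPn/negP => /pval_ev[].
by rewrite rmorphB /= eq_fg subrr eqxx.
Qed.

Lemma ev_eq0 f : (ev f == 0) = (f == 0).
Proof. by rewrite -(rmorph0 ev) (inj_eq ev_inj). Qed.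

Definition comb a : K := \sum_i ev (a 0 i) * x i.

Lemma combD a b : comb (a + b) = comb a + comb b.
Proof. by rewrite -big_split /=; apply: eq_bigr => i _; rewrite mxE rmorphD mulrDl. Qed.

Lemma combZ f a : comb (f *: a) = ev f * comb a.
Proof. by rewrite mulr_sumr; apply: eq_bigr => i _; rewrite mxE rmorphM mulrA. Qed.

Lemma comb0 : comb 0 = 0.
Proof. by rewrite -(scale0r (0 : 'rV_n)) combZ rmorph0 mul0r. Qed.

Lemma comb_sum (I : Type) (r : seq I) (P : pred I) (F : I -> 'rV_n) :
  comb (\sum_(i <- r | P i) F i) = \sum_(i <- r | P i) comb (F i).
Proof.
exact: (big_morph comb combD comb0).
Qed.

Lemma comb_delta i : comb (delta_mx 0 i) = x i.
Proof.
rewrite /comb (bigD1 i) //= !mxE !eqxx rmorph1 mul1r big1 ?addr0 // => j ji.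
by rewrite mxE (negPf ji) andbF rmorph0 mul0r.
Qed.

Lemma combA a : inA q (comb a).
Proof. by apply: inA_sum => i _; apply: inAM => //; exact: inA_ev. Qed.

(* The pole orders n * deg a_i + s_i are pairwise distinct, being distinct modulo n. *)
Lemma gev_comb m a : gev q m (comb a) -> forall i, gev q m (ev (a 0 i) * x i).
Proof.
apply: gev_sum_distinct => i j ij; rewrite !mulf_eq0 !negb_or => /andP[ai _] /andP[aj _].
rewrite ev_eq0 in ai; rewrite ev_eq0 in aj.
have [ei qi] := pval_ev ai; have [ej qj] := pval_ev aj.
rewrite !pvalM // qi qj !qx -!opprD eqr_opp -!PoszD eqz_nat; apply: contra ij => /eqP eq_ij.
apply/eqP/val_inj; rewrite /= -(s_mod i) -(s_mod j).
by rewrite -(modnMDl (size (a 0 i)).-1 (s i)) -(modnMDl (size (a 0 j)).-1 (s j)) ![(_ * n)%N]mulnC eq_ij.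
Qed.

Lemma comb_inj : injective comb.
Proof.
move=> a b eq_ab; apply/rowP => i; apply/eqP; rewrite -subr_eq0.
have h m : gev q m (ev ((a - b) 0 i) * x i).
  apply: gev_comb.
  have -> : comb (a - b) = comb a - comb b.
    by rewrite -scaleN1r combD combZ rmorphN1 mulN1r.
  by rewrite eq_ab subrr gev0.
have := h (q (ev ((a - b) 0 i) * x i) + 1).
rewrite /gev gerDl orbF mulf_eq0 (negPf (x0 i)) orbF ev_eq0 mxE mxE.
by [].
Qed.

(** A multiple [iota c * t ^+ d * x i] with the same leading pole is subtracted until the pole order
    drops to nothing. The regularity hypothesis stands under the existential so that [coord] can be
    a total function. *)
Lemma comb_surj y : exists a, inA q y -> y = comb a.
Proof.
have [hy|] := pselect (inA q y); last by exists 0.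
suff h m : forall y, inA q y -> gev q (1 - m%:Z) y -> exists a, y = comb a.
  have [|a ->] := h `|q y|.+1 y hy; last by exists a.
  by apply: gevW (gev_refl q y); lia.
elim: m => [|m IHm] {hy}y hy hm.
  rewrite subr0 in hm; rewrite (inA_eq0 Hgen HK hy hm); exists 0.
  by rewrite comb0.
have [|] := boolP (gev q (1 - m%:Z) y); first exact: IHm.
rewrite negb_or => /andP[y0 lt_m].
have qy : q y = - m%:Z by move: hm; rewrite gevE //; lia.
have ng : nongap q m by exists y.
pose i : 'I_n := Ordinal (ltn_pmod m (ltn0Sn n')).
have le_sm : (s i <= m)%N by exact: s_min.
have dvd_n : (m - s i = (m - s i) %/ n * n)%N.
  by apply/eqP; rewrite eq_sym -dvdn_eq -eqn_mod_dvd // s_mod.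
set d := ((m - s i) %/ n)%N in dvd_n.
have w0 : t ^+ d * x i != 0 by rewrite mulf_neq0 ?expf_neq0.
have qw : q (t ^+ d * x i) = - m%:Z.
  rewrite pvalM ?expf_neq0 // pvalX qt qx mulrn_int mulNr -PoszM mulnC -dvd_n; lia.
have [|c hc] := residue_sub HK (p := q) (x := y) w0; first by rewrite qw gevE // qy.
have [||a ha] := IHm (y - iota c * (t ^+ d * x i)).
- apply: inAB => //; apply: inAM; first exact: inAC.
  by apply: inAM => //; exact: inAX.
- by move: hc; rewrite qw addrC.
exists (a + (c *: 'X^d) *: delta_mx 0 i).
rewrite combD -ha combZ comb_delta -mul_polyC rmorphM rmorphXn /= evC evX mulrA.
by rewrite -!mulrA subrK.
Qed.

Definition coord y : 'rV_n := sval (cid (comb_surj y)).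

Lemma coordK y : inA q y -> comb (coord y) = y.
Proof. by move=> hy; rewrite /coord; case: cid => a /= ->. Qed.

Lemma combK a : coord (comb a) = a.
Proof. by apply: comb_inj; rewrite coordK //; exact: combA. Qed.

Lemma coordD y z : inA q y -> inA q z -> coord (y + z) = coord y + coord z.
Proof. by move=> hy hz; rewrite -{1}(coordK hy) -{1}(coordK hz) -combD combK. Qed.

Lemma coordZ f y : inA q y -> coord (ev f * y) = f *: coord y.
Proof. by move=> hy; rewrite -{1}(coordK hy) -combZ combK. Qed.

(** * Multiplication matrices, trace form and discriminant *)

Definition mulA_mx y : 'M[{poly k}]_n := \matrix_i coord (y * x i).

Lemma row_mulA_mx y i : row i (mulA_mx y) = coord (y * x i).
Proof. exact: rowK. Qed.

Lemma mul_comb y a : inA q y -> y * comb a = comb (a *m mulA_mx y).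
Proof.
move=> hy; rewrite mulmx_sum_row comb_sum mulr_sumr; apply: eq_bigr => i _.
by rewrite combZ row_mulA_mx (coordK (inAM hy (xA i))) mulrCA.
Qed.

Lemma coordM y z : inA q y -> inA q z -> coord (y * z) = coord z *m mulA_mx y.
Proof. by move=> hy hz; rewrite -{1}(coordK hz) mul_comb // combK. Qed.

Lemma mulA_mxM y z : inA q y -> inA q z -> mulA_mx (y * z) = mulA_mx y *m mulA_mx z.
Proof.
move=> hy hz; apply/row_matrixP => i.
rewrite row_mul !row_mulA_mx -coordM //; last exact: inAM.
by congr coord; rewrite mulrCA mulrA.
Qed.

Lemma mulA_mxD y z : inA q y -> inA q z -> mulA_mx (y + z) = mulA_mx y + mulA_mx z.
Proof.
move=> hy hz; apply/row_matrixP => i; rewrite raddfD /= !row_mulA_mx mulrDl.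
by apply: coordD; exact: inAM.
Qed.

Lemma mulA_mxZ f y : inA q y -> mulA_mx (ev f * y) = f *: mulA_mx y.
Proof.
move=> hy; apply/row_matrixP => i; rewrite linearZ /= !row_mulA_mx -mulrA.
by apply: coordZ; exact: inAM.
Qed.

Lemma mulA_mx1 : mulA_mx 1 = 1%:M.
Proof.
apply/row_matrixP => i; rewrite row_mulA_mx mul1r -(comb_delta i) combK.
by rewrite rowE mulmx1.
Qed.

Lemma mulA_mxX y m : inA q y -> mulA_mx (y ^+ m) = (mulA_mx y) ^+ m.
Proof.
move=> hy; elim: m => [|m IHm]; first by rewrite !expr0 mulA_mx1.
by rewrite !exprS mulA_mxM ?IHm //; exact: inAX.
Qed.

Definition trA y : {poly k} := \tr (mulA_mx y).

Lemma trAD y z : inA q y -> inA q z -> trA (y + z) = trA y + trA z.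
Proof. by move=> hy hz; rewrite /trA mulA_mxD // raddfD. Qed.

Lemma trAZ f y : inA q y -> trA (ev f * y) = f * trA y.
Proof. by move=> hy; rewrite /trA mulA_mxZ // mxtraceZ. Qed.

Lemma trA_sum (I : Type) (r : seq I) (P : pred I) (F : I -> K) :
  (forall i, P i -> inA q (F i)) ->
  trA (\sum_(i <- r | P i) F i) = \sum_(i <- r | P i) trA (F i).
Proof.
move=> hF; elim: r => [|i r IHr].
  by rewrite !big_nil -(mul0r 1) -(rmorph0 ev) trAZ ?mul0r //; exact: inA1.
rewrite !big_cons; case: ifP => // Pi.
by rewrite trAD ?IHr //; [exact: hF | exact: inA_sum].
Qed.

Lemma trA1 : trA 1 = n%:R.
Proof. by rewrite /trA mulA_mx1 mxtrace1. Qed.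

Definition gram := \matrix_(i, j) trA (x i * x j).

Lemma mulA_mx_det_neq0 y : y != 0 -> inA q y -> \det (mulA_mx y) != 0.
Proof.
move=> y0 hy; apply/negP => /det0P[a a0 ha].
have /eqP := mul_comb a hy; rewrite ha.
rewrite comb0 mulf_eq0 (negPf y0) /= -comb0 (inj_eq comb_inj).
by rewrite (negPf a0).
Qed.

(** Cramer's rule: the norm of [y], the determinant of multiplication by [y], is a multiple of
    [y]. *)
Lemma inA_invertible y : y != 0 -> inA q y ->
  exists z f, [/\ inA q z, f != 0 & y * z = ev f].
Proof.
move=> y0 hy; exists (comb (coord 1 *m \adj (mulA_mx y))), (\det (mulA_mx y)).
split; [exact: combA | exact: mulA_mx_det_neq0 |].
rewrite mul_comb // -mulmxA mul_adj_mx mul_mx_scalar combZ coordK ?mulr1 //.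
exact: inA1.
Qed.

Lemma natf_neq0 : n%:R != 0 :> {poly k}.
Proof. by have /pcharf0P h := char0; rewrite -polyC_natr polyC_eq0 h. Qed.

(** A nonzero [y] has a multiple that is a nonzero polynomial [f] in [t], of trace n f; this is
    nonzero in characteristic zero. *)
Lemma trA_nondeg y : inA q y -> (forall j, trA (y * x j) = 0) -> y = 0.
Proof.
move=> hy tr0; apply/eqP/negPn/negP => y0.
have [z [f [hz f0 yz]]] := inA_invertible y0 hy.
have : trA (y * z) = 0.
  rewrite -(coordK hz) mulr_sumr trA_sum => [|i _]; last first.
    by apply: inAM => //; apply: inAM => //; exact: inA_ev.
  by rewrite big1 // => i _; rewrite mulrCA trAZ ?tr0 ?mulr0 //; exact: inAM.
rewrite yz -[ev f]mulr1 trAZ; last exact: inA1.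
by rewrite trA1 => /eqP; rewrite mulf_eq0 (negPf f0) (negPf natf_neq0).
Qed.

Lemma gram_det_neq0 : \det gram != 0.
Proof.
apply/negP => /det0P[a a0 ha]; move/negP: a0; apply.
rewrite -(inj_eq comb_inj) comb0; apply/eqP/trA_nondeg; first exact: combA.
move=> j; have /rowP/(_ j) := ha; rewrite !mxE => <-.
rewrite mulr_suml trA_sum => [|i _]; last first.
  by apply: inAM => //; apply: inAM => //; exact: inA_ev.
apply: eq_bigr => i _; rewrite -mulrA trAZ ?mxE //; exact: inAM.
Qed.

(** As terms of [comb] do not cancel, the component of [y * x i] along [x i] has no larger pole at
    [q] than [y * x i] itself; dividing by [x i] bounds each diagonal entry. *)
Lemma gev_trA y e : inA q y -> gev q (- e%:Z) y -> gev q (- e%:Z) (ev (trA y)).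
Proof.
move=> hy qy; rewrite /trA /mxtrace rmorph_sum; apply: gev_sum => i _ /=.
have h : gev q (- e%:Z - (s i)%:Z) (comb (coord (y * x i))).
  rewrite coordK; last exact: inAM.
  by apply: gevM => //; rewrite -qx gev_refl.
have := gev_comb h i; rewrite mxE.
rewrite -qx => {}h; have := gevM h (gev_refl q (x i)^-1).
by rewrite pvalV addrK mulfK.
Qed.

Lemma size_gram_det : (n * (size (\det gram)).-1 <= 2 * \sum_i s i)%N.
Proof.
have : gev q (- (2 * \sum_i s i)%:Z) (ev (\det gram)).
  rewrite /determinant rmorph_sum; apply: gev_sum => sg _ /=.
  rewrite rmorphM rmorph_sign; apply: gevMl.
    by rewrite -signr_odd; case: odd; rewrite ?expr1 ?gevN gev1.
  rewrite rmorph_prod /=.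
  have -> : - (2 * \sum_i s i)%:Z = \sum_i - (s i + s (sg i))%:Z.
    rewrite sumrN -(big_morph Posz PoszD erefl) big_split /= mul2n -addnn.
    by rewrite [X in - Posz (X + _)](reindex_inj (@perm_inj _ sg)) addnC.
  apply: gev_prod => i _; rewrite mxE; apply: gev_trA; first exact: inAM.
  rewrite PoszD opprD; apply: gevM; by rewrite -qx gev_refl.
have [e0 qe] := pval_ev gram_det_neq0.
by rewrite gevE // qe lerN2 lez_nat.
Qed.

(** * Fibres of t and ramification *)

Lemma fibre c : exists P : seq (place iota), [/\ uniq P,
  forall p, (p \in P) = gev p 1 (t - iota c) & \sum_(p <- P) p (t - iota c) = n%:Z].
Proof.
have yE : t - iota c = ev ('X - c%:P) by rewrite rmorphB /= evX evC.
have [y0 qy] := pval_ev (negbT (polyXsubC_eq0 c)); rewrite -yE size_XsubC /= muln1 in y0 qy.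
set y := t - iota c in y0 qy *; have yA : inA q y by apply: inAB => //; exact: inAC.
have [r [ur hr]] := pval_support Hgen HK y.
have qr : q \in r by apply/negPn/negP => /hr; rewrite qy.
exists [seq p <- r | gev p 1 y]; split; first exact: filter_uniq.
  move=> p; rewrite mem_filter; apply: andb_idr => hp; apply/negPn/negP => /hr.
  by move: hp; rewrite gevE // => + py; rewrite py.
rewrite big_filter; have := sum_pval_eq0 Hgen y0 ur hr.
rewrite (bigID (fun p : place iota => gev p 1 y)) /=.
suff -> : \sum_(p <- r | ~~ gev p 1 y) p y = - n%:Z by move/eqP; rewrite subr_eq0 => /eqP.
rewrite big_mkcond (bigD1_seq q) //= [X in ~~ X](_ : _ = false); last first.
  by rewrite gevE // qy.
rewrite big1 ?addr0 // => p pq; case: ifP => // hp.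
by have := yA p pq; move: hp; rewrite !gevE //; lia.
Qed.

(* w vanishes on the whole fibre of t over c, so w ^+ n is divisible by t - c and
   multiplication by w is nilpotent modulo 'X - c. *)
Lemma root_trA c (P : seq (place iota)) w : uniq P -> (forall p, (p \in P) = gev p 1 (t - iota c)) ->
  \sum_(p <- P) p (t - iota c) = n%:Z -> inA q w ->
  (forall p, p \in P -> gev p 1 w) -> root (trA w) c.
Proof.
move=> uP hP sumP wA wP.
have yE : t - iota c = ev ('X - c%:P) by rewrite rmorphB /= evX evC.
have [y0 qy] := pval_ev (negbT (polyXsubC_eq0 c)); rewrite -yE size_XsubC /= muln1 in y0 qy.
have yA : inA q (t - iota c) by apply: inAB => //; exact: inAC.
have uA : inA q (w ^+ n / (t - iota c)).
  move=> p pq; have [pP|] := boolP (p \in P).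
    have hw : gev p n%:Z (w ^+ n) by have := gevX n (wP p pP); rewrite mulrn_int mul1r.
    apply: gevW (gevM hw (gev_refl p _)); rewrite pvalV subr_ge0 -sumP.
    rewrite (bigD1_seq p) //= lerDl big_seq_cond sumr_ge0 // => p' /andP[].
    by rewrite hP gevE // => h _; apply: le_trans h.
  rewrite hP gevE // => hp; have := yA p pq; rewrite gevE // => hp'.
  apply: gevMl; last by rewrite gevE ?invr_eq0 // pvalV; lia.
  by rewrite -[0](mul0rn _ n) gevX ?wA.
have := mulA_mxX n wA; rewrite -[w ^+ n](divfK y0) mulrC yE mulA_mxZ -?yE // => /esym hM.
have : (map_mx (horner_eval c) (mulA_mx w)) ^+ n = 0.
  rewrite -rmorphXn /= hM; apply/matrixP => i j; rewrite !mxE /horner_eval hornerM.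
  by rewrite hornerXsubC subrr mul0r.
by move/nilpotent_trace; rewrite trace_map_mx /horner_eval => /eqP.
Qed.

(** The matrix [E] of values of the [x i] at the points of the fibre has rank at most [size P].
    After an invertible change of basis [L] over [k], the remaining elements [y i] vanish on the
    whole fibre, so by [root_trA] their rows of the Gram matrix are divisible by 'X - c. *)
Lemma fibre_dvd c (P : seq (place iota)) : uniq P -> (forall p, (p \in P) = gev p 1 (t - iota c)) ->
  \sum_(p <- P) p (t - iota c) = n%:Z ->
  ('X - c%:P) ^+ (n - size P) %| \det gram.
Proof.
move=> uP hP sumP.
have Pq p : p \in P -> p != q.
  rewrite hP; apply: contraTneq => ->.
  have [y0 qy] := pval_ev (negbT (polyXsubC_eq0 c)).
  rewrite rmorphB /= evX evC in y0 qy.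
  by rewrite gevE // qy size_XsubC.
have /choice[rs hrs] : forall py : place iota * K, exists c' : k,
    gev py.1 0 py.2 -> gev py.1 1 (py.2 - iota c').
  move=> [p y] /=; have [/(residue HK)[c' hc]|] := boolP (gev p 0 y); last by exists 0.
  by exists c'.
pose E := \matrix_(i < n, j < size P) rs (nth q P j, x i).
pose L := invmx (col_ebase E).
have LE : L *m E = pid_mx (\rank E) *m row_ebase E.
  by rewrite -{1}(mulmx_ebase E) -mulmxA mulKmx // col_ebase_unit.
have L0 (i : 'I_n) j : (\rank E <= i)%N -> (L *m E) i j = 0.
  move=> le_i; rewrite LE !mxE big1 // => l _.
  by rewrite mxE ltnNge le_i andbF mul0r.
pose y i := \sum_l iota (L i l) * x l.
have yA i : inA q (y i) by apply: inA_sum => l _; apply: inAM => //; exact: inAC.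
have yP (i : 'I_n) p : (\rank E <= i)%N -> p \in P -> gev p 1 (y i).
  move=> le_i pP; have jP : (index p P < size P)%N by rewrite index_mem.
  have -> : y i = \sum_l iota (L i l) * (x l - iota (E l (Ordinal jP))).
    under eq_bigr => l _ do rewrite mulrBr -rmorphM.
    rewrite sumrB -rmorph_sum /=.
    by have := L0 _ (Ordinal jP) le_i; rewrite mxE => ->; rewrite rmorph0 subr0.
  apply: gev_sum => l _; apply: gevZ; rewrite mxE /= nth_index //.
  by apply: (hrs (p, x l)); apply: xA; exact: Pq.
have GE i j : (map_mx polyC L *m gram) i j = trA (y i * x j).
  rewrite mxE mulr_suml trA_sum => [|l _]; last first.
    by apply: inAM => //; apply: inAM => //; exact: inAC.
  apply: eq_bigr => l _; rewrite !mxE -mulrA -(evC iota t) trAZ //; exact: inAM.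
have /(@dvdp_det_rows _ _ _ _ (\rank E)) : forall i j : 'I_n, (\rank E <= i)%N ->
    'X - c%:P %| (map_mx polyC L *m gram) i j.
  move=> i j le_i; rewrite GE dvdp_XsubCl; apply: (root_trA uP) => //; first exact: inAM.
  move=> p pP; rewrite mulrC; apply: gevMl; first by apply: xA; exact: Pq.
  exact: yP.
rewrite det_mulmx det_map_mx mul_polyC dvdpZr; last first.
  by rewrite -unitfE -unitmxE unitmx_inv col_ebase_unit.
apply: dvdp_trans; apply: dvdp_exp2l; rewrite leq_sub2l //; exact: rank_leq_col.
Qed.

(** Here [r p] is the value of [t] at [p]. Factors for distinct values are coprime, so the
    divisibilities of [fibre_dvd] multiply, and the exponent n - size P is the sum of e_p - 1 over
    the whole fibre, of which [T] may contain only a part. *)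
Lemma ramification_bound (T : seq (place iota)) (r : place iota -> k) :
  uniq T -> (forall p, p \in T -> gev p 1 (t - iota (r p))) ->
  \sum_(p <- T) (p (t - iota (r p)) - 1) <= (size (\det gram)).-1%:Z.
Proof.
move=> uT hT; pose cs := undup [seq r p | p <- T].
have /choice[P hP] := fibre.
have dvd : \prod_(c <- cs) ('X - c%:P) ^+ (n - size (P c)) %| \det gram.
  have : uniq cs by exact: undup_uniq.
  elim: cs => [|c cs IHcs]; first by rewrite big_nil dvd1p.
  move=> /= /andP[ccs ucs]; rewrite big_cons Gauss_dvdp.
    by rewrite IHcs // andbT; have [uP mP sP] := hP c; exact: fibre_dvd.
  rewrite coprimep_expl // big_seq; elim/big_rec: _ => [|c' f c'cs hf]; first exact: coprimep1.
  rewrite coprimepMr hf andbT coprimep_expr // coprimep_XsubC root_XsubC.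
  by apply: contraNneq ccs => <-.
have /(dvdp_leq gram_det_neq0) := dvd.
have -> : size (\prod_(c <- cs) ('X - c%:P) ^+ (n - size (P c))) = (\sum_(c <- cs) (n - size (P c))).+1.
  elim: (cs) => [|c cs' IHcs]; first by rewrite !big_nil size_poly1.
  rewrite !big_cons size_mul; last 2 first.
  - by rewrite expf_neq0 // polyXsubC_eq0.
  - by rewrite -size_poly_eq0 IHcs.
  by rewrite IHcs size_exp_XsubC addSn addnS.
move=> hs; apply: (@le_trans _ _ (\sum_(c <- cs) (n - size (P c)))%N%:Z); last by rewrite lez_nat -ltnS (leq_trans hs) // leqSpred.
have -> : \sum_(p <- T) (p (t - iota (r p)) - 1) =
    \sum_(c <- cs) \sum_(p <- T | r p == c) (p (t - iota c) - 1).
  under [RHS]eq_bigr => c _ do rewrite big_mkcond.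
  rewrite exchange_big /=; apply: eq_big_seq => p pT.
  rewrite (bigD1_seq (r p)) ?undup_uniq ?mem_undup ?map_f //= eqxx.
  by rewrite big1 ?addr0 // => c /negPf; rewrite eq_sym => ->.
rewrite (big_morph Posz PoszD erefl); apply: ler_sum => c _.
have [uP mP sP] := hP c.
have y0 : t - iota c != 0.
  have [] := pval_ev (negbT (polyXsubC_eq0 c)).
  by rewrite rmorphB /= evX evC.
have P1 p : p \in P c -> 0 <= p (t - iota c) - 1 by rewrite mP gevE // subr_ge0.
have sP1 : \sum_(p <- P c) (p (t - iota c) - 1) = n%:Z - (size (P c))%:Z.
  by rewrite sumrB sP big_const_seq count_predT iter_addr addr0 natz.
have le_n : (size (P c) <= n)%N.
  have : 0 <= \sum_(p <- P c) (p (t - iota c) - 1).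
    by rewrite big_seq_cond sumr_ge0 // => p /andP[/P1].
  by rewrite sP1 subr_ge0 lez_nat.
rewrite -subzn // -sP1 -big_filter; apply: ler_sum_subset => //; first exact: filter_uniq.
by move=> p; rewrite mem_filter mP => /andP[/eqP<- /hT].
Qed.

(** * The derivation on functions regular off q *)

Definition dA y : K := comb (map_mx (@deriv k) (coord y)).

Lemma dAA y : inA q (dA y).
Proof. exact: combA. Qed.

Lemma dAD y z : inA q y -> inA q z -> dA (y + z) = dA y + dA z.
Proof.
move=> hy hz; rewrite /dA coordD // -combD; congr comb.
by apply/rowP => i; rewrite !mxE derivD.
Qed.

Lemma dAZ f y : inA q y -> dA (ev f * y) = ev f^`() * y + ev f * dA y.
Proof.
move=> hy; rewrite /dA coordZ // -{2}(coordK hy) -!combZ -combD; congr comb.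
by apply/rowP => i; rewrite !mxE derivM.
Qed.

(* Coordinatewise differentiation is not a derivation; its defect is a Hochschild 2-cocycle. *)
Definition dA_defect y z := dA (y * z) - y * dA z - z * dA y.

Lemma dA_defectD y y' z : inA q y -> inA q y' -> inA q z ->
  dA_defect (y + y') z = dA_defect y z + dA_defect y' z.
Proof.
move=> hy hy' hz; rewrite /dA_defect mulrDl !dAD //; try exact: inAM.
by ring.
Qed.

Lemma dA_defectZ f y z : inA q y -> inA q z ->
  dA_defect (ev f * y) z = ev f * dA_defect y z.
Proof.
move=> hy hz; rewrite /dA_defect -mulrA !dAZ //; last exact: inAM.
by ring.
Qed.

Lemma dA_defectC y z : dA_defect y z = dA_defect z y.
Proof. by rewrite /dA_defect mulrC addrAC. Qed.

Lemma dA_defect_comb a z : inA q z ->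
  dA_defect (comb a) z = \sum_i ev (a 0 i) * dA_defect (x i) z.
Proof.
move=> hz.
suff [] : dA_defect (comb a) z = \sum_i ev (a 0 i) * dA_defect (x i) z /\ inA q (comb a) by [].
rewrite /comb; elim: (index_enum _) => [|i r [IH1 IH2]].
  rewrite !big_nil; split; last exact: inA0.
  by rewrite -(mul0r 1) -(rmorph0 ev) dA_defectZ ?rmorph0 ?mul0r //; exact: inA1.
have hi : inA q (ev (a 0 i) * x i) by apply: inAM => //; exact: inA_ev.
rewrite !big_cons; split; last exact: inAD.
by rewrite dA_defectD // IH1 dA_defectZ.
Qed.

Lemma dA_cocycle w y z : w * dA_defect y z - dA_defect (w * y) z
  + dA_defect w (y * z) - dA_defect w y * z = 0.
Proof. by rewrite /dA_defect -[w * y * z]mulrA; ring. Qed.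

(* The basis dual to x for the trace form, multiplied by the discriminant. *)
Definition dual_basis i : K := comb (row i (\adj gram)).

Lemma mulA_mx_gram y : inA q y -> mulA_mx y *m gram = \matrix_(i, j) trA (y * x i * x j).
Proof.
move=> hy; apply/matrixP => i j; rewrite !mxE.
have yx : inA q (y * x i) by exact: inAM.
rewrite -{1}(coordK yx) mulr_suml trA_sum => [|l _]; last first.
  by apply: inAM => //; apply: inAM => //; exact: inA_ev.
apply: eq_bigr => l _; rewrite !mxE -mulrA trAZ //; exact: inAM.
Qed.

(** Multiplication is self-adjoint for the trace form; the identity follows by multiplying with the
    adjugate on both sides and cancelling the discriminant. *)
Lemma adj_gram_mulA_mx y : inA q y -> \adj gram *m mulA_mx y = (mulA_mx y)^T *m \adj gram.
Proof.
move=> hy; have comm : mulA_mx y *m gram = gram *m (mulA_mx y)^T.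
  have gramT : gram^T = gram by apply/matrixP => i j; rewrite !mxE mulrC.
  rewrite -{2}gramT -trmx_mul mulA_mx_gram //; apply/matrixP => i j.
  by rewrite !mxE; congr trA; rewrite mulrAC.
have : \adj gram *m (mulA_mx y *m gram) *m \adj gram
     = \adj gram *m (gram *m (mulA_mx y)^T) *m \adj gram by rewrite comm.
rewrite -!mulmxA mul_mx_adj !mulmxA mul_adj_mx -mulmxA mul_mx_scalar -mulmxA mul_scalar_mx.
move=> /matrixP h; apply/matrixP => i j; apply: (mulfI gram_det_neq0).
by have := h i j; rewrite -scalemxAr mxE => ->; rewrite mxE.
Qed.

(** On the dual basis [y] acts by the transposed matrix: in the sum of the tensors of [x i] with
    [dual_basis i], the factor [y] may be moved from one side to the other. *)
Lemma casimir y l : inA q y ->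
  y * dual_basis l = \sum_i ev (mulA_mx y i l) * dual_basis i.
Proof.
move=> hy; rewrite /dual_basis mul_comb // -row_mul adj_gram_mulA_mx // row_mul.
rewrite mulmx_sum_row comb_sum; apply: eq_bigr => i _.
by rewrite combZ !mxE.
Qed.

(** By nondegeneracy it is enough to take traces against each [x j]; both sides give the
    discriminant times the trace of [x j]. *)
Lemma casimir_trace : \sum_i x i * dual_basis i = ev (\det gram).
Proof.
have dA_ i : inA q (x i * dual_basis i) by apply: inAM => //; exact: combA.
have sA : inA q (\sum_i x i * dual_basis i) by exact: inA_sum.
apply/eqP; rewrite -subr_eq0; apply/eqP/trA_nondeg.
  by apply: inAB => //; exact: inA_ev.
move=> j; rewrite mulrBl -mulNr -rmorphN /= trAD ?trAZ //; last 2 first.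
- exact: inAM.
- by apply: inAM => //; exact: inA_ev.
rewrite mulr_suml trA_sum => [|i _]; last exact: inAM.
have -> : \sum_i trA (x i * dual_basis i * x j) = \tr (\adj gram *m (mulA_mx (x j) *m gram)).
  apply: eq_bigr => i _; rewrite mxE mulrAC mulr_sumr trA_sum => [|l _]; last first.
    by apply: inAM; [exact: inAM | apply: inAM => //; exact: inA_ev].
  apply: eq_bigr => l _; rewrite mulA_mx_gram // !mxE mulrCA trAZ; last by do !apply: inAM.
  by congr (_ * trA _); rewrite -!mulrA mulrCA [x l * x i]mulrC.
by rewrite mxtrace_mulC -mulmxA mul_mx_adj mul_mx_scalar mxtraceZ mulNr subrr.
Qed.

(** This is d/dt scaled by the discriminant, the factor that keeps the dual basis, and so the
    correction term, inside the ring. *)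
Definition derA y : K := ev (\det gram) * dA y + \sum_i dual_basis i * dA_defect (x i) y.

Lemma derAA y : inA q y -> inA q (derA y).
Proof.
move=> hy; apply: inAD; first by apply: inAM; [exact: inA_ev | exact: dAA].
apply: inA_sum => i _; apply: inAM; first exact: combA.
by apply: inAB; [apply: inAB|]; try apply: inAM; try exact: dAA.
Qed.

Lemma derAD y z : inA q y -> inA q z -> derA (y + z) = derA y + derA z.
Proof.
move=> hy hz; rewrite /derA dAD //.
under eq_bigr => i _ do rewrite dA_defectC dA_defectD // mulrDr !(dA_defectC _ (x i)).
by rewrite big_split /=; ring.
Qed.

Lemma derAZ f y : inA q y -> derA (ev f * y) = ev (\det gram * f^`()) * y + ev f * derA y.
Proof.
move=> hy; rewrite /derA dAZ // rmorphM.
under eq_bigr => i _ do rewrite dA_defectC dA_defectZ // mulrCA (dA_defectC _ (x i)).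
by rewrite -mulr_sumr /=; ring.
Qed.

(* The dual basis is a Casimir element, which makes the cocycle dA_defect a coboundary. *)
Lemma derAM y z : inA q y -> inA q z -> derA (y * z) = y * derA z + z * derA y.
Proof.
move=> hy hz; pose phi w := \sum_i dual_basis i * dA_defect (x i) w.
have phi_mul : \sum_i dual_basis i * dA_defect (x i * y) z = y * phi z.
  under eq_bigr => i _.
    rewrite [x i * y]mulrC -(coordK (inAM hy (xA i))) dA_defect_comb // mulr_sumr.
    over.
  rewrite exchange_big mulr_sumr /=; apply: eq_bigr => l _.
  rewrite mulrA casimir // mulr_suml; apply: eq_bigr => i _.
  by rewrite mxE mulrCA mulrA.
have : \sum_i dual_basis i * (x i * dA_defect y z - dA_defect (x i * y) z
  + dA_defect (x i) (y * z) - dA_defect (x i) y * z) = 0.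
  by rewrite big1 // => i _; rewrite dA_cocycle mulr0.
under eq_bigr => i _ do rewrite mulrBr mulrDr mulrBr mulrA [dual_basis i * x i]mulrC [_ * (_ * z)]mulrA.
rewrite !(sumrB, big_split) /= -!mulr_suml casimir_trace phi_mul -/(phi (y * z)) -/(phi y).
have -> : derA (y * z) = ev (\det gram) * (dA_defect y z + y * dA z + z * dA y) + phi (y * z).
  by rewrite /derA /dA_defect; congr (_ * _ + _); ring.
rewrite /derA -/(phi y) -/(phi z) => h.
by apply/eqP; rewrite -subr_eq0; apply/eqP; rewrite -[RHS]h; ring.
Qed.

Lemma derA1 : derA 1 = 0.
Proof.
have hA1 : inA q 1 by exact: inA1.
have := derAM hA1 hA1; rewrite !mul1r => /eqP.
by rewrite -subr_eq0 opprD addNKr oppr_eq0 => /eqP.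
Qed.

Lemma derA_ev f : derA (ev f) = ev (\det gram * f^`()).
Proof. by rewrite -[ev f]mulr1 derAZ ?derA1 ?mulr0 ?addr0 ?mulr1 //; exact: inA1. Qed.

(** * Extension of the derivation to K *)

Lemma inA_frac p y : exists ab : K * K, [/\ inA q ab.1, inA q ab.2, ab.2 != 0,
  y = ab.1 / ab.2 & p != q -> gev p 0 y -> p ab.2 = 0].
Proof.
have [r [ur hr]] := pval_support Hgen HK y.
pose T := undup (q :: p :: r); have uT : uniq T by exact: undup_uniq.
pose N : int := 2 * gen%:Z + \sum_(p' <- T) `|p' y|.
(* The denominator [b] must cancel the poles of [y] off [q], and [N] allows it enough poles at [q].
   Its order at [p] is exact, so [b] is a unit at [p] whenever [y] is regular there and [p] is not
   [q]; [derK_integral] relies on this. *)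
pose D p' : int := if p' == q then N else if gev p' 0 y then 0 else p' y.
have DT p' : p' \notin T -> D p' = 0.
  rewrite mem_undup !in_cons => /norP[p'q /norP[_ /hr p'y]].
  by rewrite /D (negPf p'q) /gev p'y orbT.
have degD : 2 * gen%:Z <= \sum_(p' <- T) D p'.
  have qT : q \in T by rewrite mem_undup mem_head.
  rewrite (bigD1_seq q) //= {1}/D eqxx /N -addrA lerDl.
  rewrite [X in _ <= X + _](bigD1_seq q) //= -addrA -big_split /=.
  rewrite addr_ge0 // sumr_ge0 // => p' /negPf p'q; rewrite /D p'q.
  by case: ifP => _; [rewrite addr0 | have := normr_ge0 (p' y); lia].
have pT : p \in T by rewrite mem_undup !inE eqxx orbT.
have [b [b0 pb bD]] := RR_exact Hgen uT DT pT degD.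
have bA : inA q b.
  move=> p' /negPf p'q; have := bD p'; rewrite /D p'q [gev p' 0 b]gevE //.
  case: ifP => [_|/negbT]; first by rewrite oppr0.
  by rewrite negb_or -ltNge => /andP[_]; lia.
exists (y * b, b); split=> //=; last 2 first.
- by rewrite mulfK.
- by move=> /negPf pq py; rewrite pb /D pq py oppr0.
move=> p' p'q; case: (eqVneq y 0) => [->|y0]; first by rewrite mul0r gev0.
rewrite gevE ?mulf_neq0 // pvalM //; have := bD p'; rewrite /D (negPf p'q).
by case: ifP; rewrite gevE // => hp' hb; lia.
Qed.

Definition quot y : K * K := sval (cid (inA_frac q y)).

(** The quotient rule for one chosen fraction, divided by the discriminant so that [t] has
    derivative 1; [derK_frac] shows that the fraction does not matter. *)
Definition derK y : K :=
  ((quot y).2 * derA (quot y).1 - (quot y).1 * derA (quot y).2)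
    / ((quot y).2 ^+ 2 * ev (\det gram)).

Lemma ev_gram_neq0 : ev (\det gram) != 0.
Proof. by rewrite ev_eq0 gram_det_neq0. Qed.

Lemma derK_frac (a b : K) : inA q a -> inA q b -> b != 0 ->
  derK (a / b) = (b * derA a - a * derA b) / (b ^+ 2 * ev (\det gram)).
Proof.
move=> aA bA b0; rewrite /derK /quot; case: cid => -[a' b'] /= [a'A b'A b'0 eq_ab _].
have eq_ab' : a * b' = a' * b.
  by rewrite -[a](divfK b0) eq_ab mulrAC divfK.
have /(congr1 derA) := eq_ab'; rewrite !derAM // => hd.
have Da : derA a = (a' * derA b + b * derA a' - a * derA b') / b'.
  by rewrite -hd addrC addKr mulrC mulKf.
have aE : a = a' * b / b' by rewrite -eq_ab' mulfK.
by rewrite Da aE; field; rewrite ev_gram_neq0 b0 b'0.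
Qed.

Lemma derKD y z : derK (y + z) = derK y + derK z.
Proof.
have [[a b] /= [aA bA b0 -> _]] := inA_frac q y.
have [[c d] /= [cA dA d0 -> _]] := inA_frac q z.
have -> : a / b + c / d = (a * d + c * b) / (b * d) by field; rewrite b0 d0.
rewrite !derK_frac ?mulf_neq0 //; try by [apply: inAM | apply: inAD; exact: inAM].
rewrite derAD ?derAM //; try exact: inAM.
by field; rewrite ev_gram_neq0 b0 d0.
Qed.

Lemma derKM y z : derK (y * z) = y * derK z + z * derK y.
Proof.
have [[a b] /= [aA bA b0 -> _]] := inA_frac q y.
have [[c d] /= [cA dA d0 -> _]] := inA_frac q z.
have -> : a / b * (c / d) = (a * c) / (b * d) by field; rewrite b0 d0.
rewrite !derK_frac ?mulf_neq0 //; try exact: inAM.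
rewrite !derAM //.
by field; rewrite ev_gram_neq0 b0 d0.
Qed.

Lemma derK_inA y : inA q y -> derK y = derA y / ev (\det gram).
Proof.
move=> hy; have hA1 : inA q 1 by exact: inA1.
by rewrite -{1}[y]divr1 derK_frac ?oner_neq0 // derA1 mulr0 subr0 mul1r expr1n mul1r.
Qed.

Lemma derK_iota c : derK (iota c) = 0.
Proof.
rewrite derK_inA; last exact: inAC.
by rewrite -(evC iota t) derA_ev derivC mulr0 rmorph0 mul0r.
Qed.

Lemma derK_t : derK t = 1.
Proof.
by rewrite derK_inA //; have := derA_ev 'X; rewrite evX derivX mulr1 => ->; rewrite divff // ev_gram_neq0.
Qed.

Lemma derA0 : derA 0 = 0.
Proof. by have := derA_ev 0; rewrite deriv0 mulr0 rmorph0. Qed.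

(* The terms of comb have distinct pole orders at q, and differentiating a polynomial in t
   does not increase its pole order. *)
Lemma derA_bounded : exists B : int, forall y, inA q y -> gev q (q y - B) (derA y).
Proof.
pose B := `|q (ev (\det gram))| + \sum_i `|q (derA (x i))|; exists B => y hy.
have [->|y0] := eqVneq y 0; first by rewrite derA0 gev0.
have hc := @gev_comb (q y) (coord y); rewrite coordK // in hc.
have {}hc i := hc (gev_refl _ _) i.
have -> : derA y = \sum_i derA (ev (coord y 0 i) * x i).
  rewrite -{1}(coordK hy) /comb.
  suff [] : derA (\sum_i ev (coord y 0 i) * x i) = \sum_i derA (ev (coord y 0 i) * x i)
    /\ inA q (\sum_i ev (coord y 0 i) * x i) by [].
  elim: (index_enum _) => [|i r [IH1 IH2]].
    by rewrite !big_nil derA0; split=> //; exact: inA0.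
  have hi : inA q (ev (coord y 0 i) * x i) by apply: inAM => //; exact: inA_ev.
  by rewrite !big_cons derAD // IH1; split=> //; exact: inAD.
apply: gev_sum => i _; rewrite derAZ // rmorphM.
have ha : gev q (q y + (s i)%:Z) (ev (coord y 0 i)).
  have := gevM (hc i) (gev_refl q (x i)^-1); rewrite mulfK // pvalV qx opprK //.
have ha' : gev q (q y + (s i)%:Z) (ev (coord y 0 i)^`()).
  move: ha; set f := coord y 0 i; have [->|f'0] := eqVneq f^`() 0; first by rewrite rmorph0 gev0.
  have f0 : f != 0 by apply: contra_neq f'0 => ->; rewrite deriv0.
  have [e0 qe] := pval_ev f0; have [e'0 qe'] := pval_ev f'0.
  rewrite !gevE // qe qe' => /le_trans; apply; rewrite lerN2 lez_nat leq_pmul2l //.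
  by rewrite -!subn1 leq_sub2r // ltnW // lt_size_deriv.
have B1 : `|q (ev (\det gram))| <= B by rewrite lerDl sumr_ge0.
have B2 : `|q (derA (x i))| <= B.
  by rewrite /B (bigD1 i) //= addrCA lerDl addr_ge0 // sumr_ge0.
clearbody B.
have hB : gev q (- B) (ev (\det gram)) by apply: gevW (gev_refl _ _); lia.
have hB' : gev q (- B) (derA (x i)) by apply: gevW (gev_refl _ _); lia.
apply: gevD; first by apply: gevW (gevM (gevM hB ha') (gev_refl q (x i))); rewrite qx; lia.
by apply: gevW (gevM ha hB'); lia.
Qed.

(** Only a loss of order uniform in [y] is claimed; [gev_der_gen] sharpens it to the true value. *)
Lemma derK_integral p : exists B, forall y, gev p 0 y -> gev p (- B) (derK y).
Proof.
have [->|pq] := eqVneq p q; last first.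
  exists (p (ev (\det gram))) => y py.
  have [[a b] /= [aA bA b0 yE pb]] := inA_frac p y.
  rewrite yE derK_frac //; rewrite -[X in gev _ X]add0r; apply: gevM.
    by apply: gevB; apply: gevMl; try exact: derAA; try exact: aA; exact: bA.
  rewrite gevE ?invr_eq0 ?mulf_neq0 ?expf_neq0 ?ev_gram_neq0 //.
  by rewrite pvalV pvalM ?expf_neq0 ?ev_gram_neq0 // pvalX pb // mul0rn add0r.
have [B hB] := derA_bounded; exists (B + q (ev (\det gram))) => y qy.
have [[a b] /= [aA bA b0 yE _]] := inA_frac q y.
have [a0|a0] := eqVneq a 0.
  by rewrite yE a0 mul0r -(rmorph0 iota) derK_iota gev0.
rewrite yE derK_frac //.
have hab : gev q (q a + q b - B) (b * derA a - a * derA b).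
  apply: gevB; [rewrite [q a + _]addrC|]; rewrite -addrA; apply: gevM; rewrite ?gev_refl //; exact: hB.
have hb := gev_refl q (b ^+ 2 * ev (\det gram))^-1.
apply: gevW (gevM hab hb); rewrite pvalV pvalM ?expf_neq0 ?ev_gram_neq0 // pvalX.
move: qy; rewrite yE gevE ?mulf_neq0 ?invr_eq0 // pvalM ?invr_eq0 // pvalV.
by rewrite mulr2n; lia.
Qed.

End TraceForm.

(** * Derivations *)

Section LocalDerivation.
Variables (k : closedFieldType) (K : fieldType) (iota : {rmorphism k -> K}).
Hypotheses (HK : is_function_field iota) (char0 : [pchar k] =i pred0).
Variable D : K -> K.
Hypotheses (DD : {morph D : x y / x + y}) (DM : forall x y, D (x * y) = x * D y + y * D x).
Hypotheses (DC : forall c, D (iota c) = 0) (t : K) (Dt : D t = 1).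
Hypothesis DB : forall p : place iota, exists B : int, forall y, gev p 0 y -> gev p (- B) (D y).
Implicit Types (p : place iota) (x y : K) (m : int).

Lemma der1 : D 1 = 0.
Proof. by rewrite -(rmorph1 iota) DC. Qed.

Lemma derZ c x : D (iota c * x) = iota c * D x.
Proof. by rewrite DM DC mulr0 addr0. Qed.

Lemma derV x : x != 0 -> D x^-1 = - (D x / x ^+ 2).
Proof.
move=> x0; have := DM x x^-1; rewrite divff // der1 => /esym/eqP.
rewrite addr_eq0 => /eqP h; apply: (mulfI x0); rewrite h.
by field.
Qed.

Lemma der_expr x n : D (x ^+ n.+1) = n.+1%:R * x ^+ n * D x.
Proof.
elim: n => [|n IHn]; first by rewrite expr1 expr0 !mul1r.
by rewrite exprS DM IHn exprS -[n.+2]addn1 natrD; ring.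
Qed.

Lemma uniformizer p : exists u, p u = 1.
Proof. by case: (pvalP p). Qed.

Definition unif p : K := sval (cid (uniformizer p)).

Lemma pval_unif p : p (unif p) = 1.
Proof. by rewrite /unif; case: cid. Qed.

Lemma unif_neq0 p : unif p != 0.
Proof. by apply/eqP => u0; have := pval_unif p; rewrite u0 pval0. Qed.

Definition nu p : int := p (D (unif p)).

Lemma unif_power p m : exists w,
  [/\ w != 0, p w = m & D w = iota m%:~R * (w / unif p * D (unif p))].
Proof.
have u0 := unif_neq0 p; have pu := pval_unif p; set u := unif p in u0 pu *.
have pos n : [/\ u ^+ n != 0, p (u ^+ n) = n & D (u ^+ n) = iota n%:R * (u ^+ n / u * D u)].
  rewrite expf_neq0 // pvalX pu natz; split=> //.
  case: n => [|n]; first by rewrite expr0 der1 rmorph0 mul0r.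
  by rewrite der_expr rmorph_nat exprSr mulfK // mulrA.
case: m => n; first by exists (u ^+ n); exact: pos.
have [w0 pw Dw] := pos n.+1; exists (u ^- n.+1); split.
- by rewrite invr_eq0.
- by rewrite pvalV pw NegzE.
rewrite derV // Dw NegzE mulrNz rmorphN; move: (u ^+ n.+1) w0 => w w0.
by field; rewrite u0 w0.
Qed.

Lemma residue_decomp p w x : w != 0 -> gev p (p w) x ->
  exists c y, [/\ x = iota c * w + y & gev p (p w + 1) y].
Proof.
move=> w0 /(residue_sub HK w0)[c hc]; exists c, (x - iota c * w); split=> //.
by rewrite addrC subrK.
Qed.

(** Bootstrapping from a crude uniform bound: write y = c w + z with [w] a power of the uniformizer
    and [z] of order one higher. The order of [D w] is controlled by [e], and the current bound
    applied to [z] gains one, until the shift e - 1 is reached. *)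
Lemma gev_der_gen p e : gev p e (D (unif p)) ->
  forall m y, gev p m y -> gev p (m - 1 + e) (D y).
Proof.
move=> he; pose Q (a : int) := forall m y, gev p m y -> gev p (m + a) (D y).
have u0 := unif_neq0 p.
have hw m : exists w : K, [/\ w != 0, p w = m & gev p (m - 1 + e) (D w)].
  have [w [w0 pw Dw]] := unif_power p m; exists w; split=> //; rewrite Dw.
  apply: gevZ; apply: gevM => //; rewrite gevE ?mulf_neq0 ?invr_eq0 //.
  by rewrite pvalM ?invr_eq0 // pvalV pval_unif pw.
have [B0 Q0] : exists B, Q (- B).
  have [B hB] := DB p; exists (`|B| + `|e - 1|) => m y hy; have [w [w0 pw Dw]] := hw m.
  rewrite -[y](divfK w0) mulrC DM; apply: gevD.
    have h : gev p 0 (y / w) by have := gevM hy (gev_refl p w^-1); rewrite pvalV pw subrr.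
    by apply: gevW (gevM (gev_refl p w) (hB _ h)); rewrite pw; lia.
  have h : gev p 0 (y / w) by have := gevM hy (gev_refl p w^-1); rewrite pvalV pw subrr.
  by apply: gevW (gevMl h Dw); lia.
have QS a : Q a -> a + 1 <= e - 1 -> Q (a + 1).
  move=> Qa le_a m y hy; have [w [w0 pw Dw]] := hw m.
  have [|c [z [-> hz]]] := residue_decomp (p := p) (x := y) w0; first by rewrite pw.
  rewrite DD derZ; apply: gevD; last by have := Qa _ _ hz; rewrite pw; apply: gevW; lia.
  by apply: gevZ; apply: gevW Dw; lia.
have Qn (n : nat) : - B0 + n%:Z <= e - 1 -> Q (- B0 + n%:Z).
  elim: n => [|n IHn]; first by rewrite addr0.
  move=> le_n; have -> : - B0 + n.+1%:Z = - B0 + n%:Z + 1 by lia.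
  by apply: QS; [apply: IHn|]; lia.
move=> m y hy; have [le_e|lt_e] := lerP (e - 1) (- B0).
  by apply: gevW (Q0 _ _ hy); lia.
have := Qn (absz (e - 1 + B0)) _ m y hy; have -> : - B0 + (absz (e - 1 + B0))%:Z = e - 1 by lia.
by move=> /(_ (lexx _)); apply: gevW; lia.
Qed.

(** If it were zero, [gev_der_gen] would apply with every [e]; the value 2 - p t makes [D t], which
    is 1, vanish at [p]. *)
Lemma der_unif_neq0 p : D (unif p) != 0.
Proof.
apply/eqP => Du0.
have := @gev_der_gen p (2 - p t) _ (p t) t (gev_refl p t).
by rewrite Du0 gev0 Dt => /(_ isT); rewrite gevE ?oner_neq0 // pval1; lia.
Qed.

Lemma gev_der p m y : gev p m y -> gev p (m - 1 + nu p) (D y).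
Proof. by apply: gev_der_gen; exact: gev_refl. Qed.

Lemma pval_der p y : y != 0 -> p y != 0 -> D y != 0 /\ p (D y) = p y - 1 + nu p.
Proof.
move=> y0 py0; have [w [w0 pw Dw]] := unif_power p (p y).
have [|c [z [yE hz]]] := residue_decomp (p := p) (x := y) w0; first by rewrite pw gev_refl.
have u0 := unif_neq0 p; have Du0 := der_unif_neq0 p.
have c0 : c != 0.
  apply: contra_eq_neq yE => ->; rewrite rmorph0 mul0r add0r; apply: contraTneq hz => <-.
  by rewrite pw gevE //; lia.
(* The leading term is multiplied by the integer [p y], which stays nonzero in characteristic
   zero. *)
have py0' : (p y)%:~R != 0 :> k.
  have /pcharf0P h := char0.
  by case: (p y) py0 => n; rewrite ?NegzE ?mulrNz ?oppr_eq0 -pmulrn h.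
have h0 : iota c * D w != 0.
  by rewrite Dw !mulf_neq0 ?fmorph_eq0 ?invr_eq0.
have hp : p (iota c * D w) = p y - 1 + nu p.
  rewrite Dw !pvalM ?mulf_neq0 ?fmorph_eq0 ?invr_eq0 // !pvalC pvalV pw pval_unif !add0r //.
rewrite yE DD derZ -yE -hp; apply: pvalDl => //; rewrite hp.
by apply: gevW (gev_der hz); rewrite pw; lia.
Qed.

(** One point suffices: after subtracting the residue at [p], a nonconstant [y] has nonzero order
    there, or it has a pole, and [pval_der] makes its derivative nonzero. *)
Lemma der_eq0 p y : D y = 0 -> exists c, y = iota c.
Proof.
move=> Dy; have [hy|hy] := boolP (gev p 0 y).
  have [c hc] := residue HK hy; exists c; apply/eqP; rewrite -subr_eq0; apply/negPn/negP => yc0.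
  have [|] := @pval_der p _ yc0; first by move: hc; rewrite gevE //; apply: contraTneq => ->.
  by rewrite -[y](subrK (iota c)) DD DC addr0 in Dy; rewrite Dy eqxx.
move: hy; rewrite negb_or -ltNge => /andP[y0 py]; have [|] := @pval_der p _ y0; first by rewrite lt_eqF.
by rewrite Dy eqxx.
Qed.

End LocalDerivation.

Section CanonicalDerivation.
Variables (k : closedFieldType) (K : fieldType) (iota : {rmorphism k -> K}).
Variables (gen : nat) (Hgen : is_genus iota gen) (HK : is_function_field iota).
Hypothesis char0 : [pchar k] =i pred0.

Record derivation_data (D : K -> K) (w : place iota -> K) : Prop := DerivationData {
  kder_add : {morph D : x y / x + y};
  kder_mul : forall x y, D (x * y) = x * D y + y * D x;
  kder_iota : forall c, D (iota c) = 0;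
  kder_ker : forall y, D y = 0 -> exists c, y = iota c;
  pval_w : forall p : place iota, p (w p) = 1;
  kder_w_neq0 : forall p, D (w p) != 0;
  gev_kder : forall (p : place iota) m y,
    gev p m y -> gev p (m - 1 + p (D (w p))) (D y)
}.

(* The orders p (D (w p)) are minus those of the differential dual to D, a canonical divisor. *)
Lemma canonical_derivation (q : place iota) : exists D w, derivation_data D w /\
  forall T : seq (place iota), uniq T -> q \in T -> 2 - 2 * gen%:Z <= \sum_(p <- T) p (D (w p)).
Proof.
have [t [x [s [[t0 tA qt] hx s_mod s_min' le_s]]]] := affine_basis Hgen HK q.
set n' := (2 * gen)%N in x s hx s_mod s_min' le_s qt.
have x0 i : x i != 0 by case: (hx i).
have xA i : inA q (x i) by case: (hx i).
have qx i : q (x i) = - (s i)%:Z by case: (hx i).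
have s_min := s_min'.
pose D := derK Hgen HK t0 tA qt x0 xA qx s_mod s_min.
have DD : {morph D : y z / y + z} by exact: derKD.
have DM y z : D (y * z) = y * D z + z * D y by exact: derKM.
have DC c : D (iota c) = 0 by exact: derK_iota.
have Dt : D t = 1 by exact: derK_t.
have DB (p : place iota) : exists B : int, forall y, gev p 0 y -> gev p (- B) (D y).
  exact: derK_integral.
exists D, (unif (iota := iota)); split.
  split=> //.
  - by move=> y; exact: (der_eq0 HK char0 DD DM DC Dt DB q).
  - exact: pval_unif.
  - exact: (der_unif_neq0 HK DD DM DC Dt DB).
  - exact: (gev_der HK DD DM DC DB).
have pval_D := pval_der HK char0 DD DM DC Dt DB.
have /choice[r hr] : forall p : place iota, exists c, p != q -> gev p 1 (t - iota c).
  move=> p; have [_|pq] := eqVneq p q; first by exists 0.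
  by have [c hc] := residue HK (tA p pq); exists c.
have tc0 c : t - iota c != 0.
  apply/negP; rewrite subr_eq0 => /eqP tE.
  by have := qt; rewrite tE pvalC.
have nu_p p : p != q -> nu D p = - (p (t - iota (r p)) - 1).
  move=> pq; have hp := hr p pq; rewrite gevE // in hp.
  have [|_] := pval_D p (t - iota (r p)) (tc0 _).
    by apply: contraTneq hp => ->.
  have -> : D (t - iota (r p)) = 1.
    by rewrite -(rmorphN iota) DD DC addr0.
  by rewrite pval1 /nu; lia.
(* From 0 = q (D t) = -n - 1 + nu. Subtracting the ramification bound n - 1 + 2 gen leaves 2 - 2
   gen. *)
have nu_q : nu D q = n'.+1%:Z + 1.
  have [|_] := pval_D q t t0; first by rewrite qt.
  by rewrite Dt pval1 qt; lia.
move=> T uT qT; rewrite (bigD1_seq q) //= -/(nu D q) nu_q.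
rewrite (eq_bigr (fun p : place iota => - (p (t - iota (r p)) - 1)) nu_p) sumrN -big_filter.
have h : forall p : place iota, p \in [seq p <- T | p != q] -> gev p 1 (t - iota (r p)).
  by move=> p; rewrite mem_filter => /andP[/hr].
have le_deg := size_gram_det Hgen HK char0 t0 tA qt x0 xA qx s_mod s_min.
have := ramification_bound Hgen HK char0 t0 tA qt x0 xA qx s_mod s_min
  (filter_uniq (fun p => p != q) uT) h.
move: le_deg; set e := (size _).-1 => le_deg le_sum.
have := leq_trans le_deg le_s; rewrite leq_pmul2l //= => le_e.
by apply: le_trans (lerB (lexx _) le_sum); move: le_e; rewrite /n'; lia.
Qed.

End CanonicalDerivation.

(** * Wronskians *)

Section Wronskian.
Variables (k : closedFieldType) (K : fieldType) (iota : {rmorphism k -> K}).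
Variables (HK : is_function_field iota) (D : K -> K) (w : place iota -> K).
Hypothesis HD : derivation_data D w.
Implicit Types (p : place iota) (x y : K) (m : int).

Local Notation nu p := ((p : place iota) (D (w p))).

Definition wronskian M (f : 'I_M -> K) : K := \det (\matrix_(i < M, j < M) iter i D (f j)).

Let DD := kder_add HD.
Let DM := kder_mul HD.
Let DC := kder_iota HD.

Lemma kder_sum (I : Type) (r : seq I) (P : pred I) (F : I -> K) :
  D (\sum_(i <- r | P i) F i) = \sum_(i <- r | P i) D (F i).
Proof. by apply: (big_morph D DD); rewrite -(rmorph0 iota) DC rmorph0. Qed.

Lemma iter_kder_lin (I : finType) (c : I -> k) (F : I -> K) i :
  iter i D (\sum_j iota (c j) * F j) = \sum_j iota (c j) * iter i D (F j).
Proof.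
elim: i => //= i ->; rewrite kder_sum; apply: eq_bigr => j _.
by rewrite DM DC mulr0 addr0.
Qed.

Lemma wronskian_kernel M (f b : 'I_M -> K) : wronskian f != 0 ->
  (forall i : 'I_M, \sum_j b j * iter i D (f j) = 0) -> forall j, b j = 0.
Proof.
move=> wf hb j; apply/eqP/negPn/negP => bj0; move/negP: wf; apply.
rewrite /wronskian -det_tr; apply/det0P; exists (\row_j b j).
  by apply/rV0Pn; exists j; rewrite mxE.
apply/rowP => i; rewrite !mxE -[RHS](hb i); apply: eq_bigr => l _.
by rewrite !mxE.
Qed.

(** Induction on the number of functions. A relation between columns is normalised to last
    coefficient 1; differentiating it gives a relation among the derivatives of the other
    coefficients, which the smaller Wronskian kills, so all coefficients are constants. *)
Lemma wronskian_neq0 M (f : 'I_M -> K) :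
  (forall c : 'I_M -> k, \sum_j iota (c j) * f j = 0 -> forall j, c j = 0) ->
  wronskian f != 0.
Proof.
elim: M f => [|M IHM] f hf; first by rewrite /wronskian det_mx00 oner_neq0.
pose g j := f (lift ord_max j).
have sumE (F : 'I_M.+1 -> K) : \sum_j F j = \sum_(j < M) F (lift ord_max j) + F ord_max.
  rewrite big_ord_recr /=; congr (_ + _); apply: eq_bigr => j _; congr F.
  by apply: val_inj; exact: esym (lift_max j).
have wg : wronskian g != 0.
  apply: IHM => c hc j.
  have := hf (fun j => if unlift ord_max j is Some j' then c j' else 0) _ (lift ord_max j).
  rewrite liftK; apply; rewrite sumE unlift_none rmorph0 mul0r addr0 -[RHS]hc.
  by apply: eq_bigr => l _; rewrite liftK.
apply/negP; rewrite /wronskian -det_tr => /det0P[v v0 hv].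
have {}hv (i : 'I_M.+1) : \sum_j v 0 j * iter i D (f j) = 0.
  have /rowP/(_ i) := hv; rewrite !mxE => hvi; rewrite -[RHS]hvi.
  by apply: eq_bigr => j _; rewrite !mxE.
have vmax : v 0 ord_max != 0.
  apply: contra_neq v0 => vmax; apply/rowP => j; rewrite mxE.
  have h := @wronskian_kernel _ g (fun j => v 0 (lift ord_max j)) wg.
  case: (unliftP ord_max j) => [j' ->|-> //]; apply: h => i.
  by have := hv (widen_ord (leqnSn M) i); rewrite sumE vmax mul0r addr0.
pose a j := v 0 j / v 0 ord_max.
have ha (i : 'I_M.+1) : \sum_j a j * iter i D (f j) = 0.
  rewrite -[RHS](mulr0 (v 0 ord_max)^-1) -[X in _ * X](hv i) mulr_sumr.
  by apply: eq_bigr => j _; rewrite /a mulrA [_^-1 * _]mulrC.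
have amax : a ord_max = 1 by rewrite /a divff.
have Da j : D (a (lift ord_max j)) = 0.
  have h := @wronskian_kernel _ g (fun j => D (a (lift ord_max j))) wg; apply: h => i.
  have := congr1 D (ha (widen_ord (leqnSn M) i)).
  rewrite kder_sum -(rmorph0 iota) DC rmorph0.
  under eq_bigr => l _ do rewrite DM.
  rewrite big_split /=.
  have -> : \sum_l a l * D (iter i D (f l)) = 0 by exact: (ha (lift ord0 i)).
  rewrite add0r sumE amax -(rmorph1 iota) DC mulr0 addr0 => hs; rewrite -[RHS]hs.
  by apply: eq_bigr => l _; rewrite mulrC.
have /choice[c hc] : forall j, exists c, a j = iota c.
  move=> j; case: (unliftP ord_max j) => [j' ->|->]; first exact: (kder_ker HD (Da j')).
  by exists 1; rewrite rmorph1.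
have := hf c _ ord_max.
under eq_bigr => j _ do rewrite -hc.
move=> /(_ (ha ord0)) cmax; move: amax; rewrite hc cmax rmorph0 => /eqP.
by rewrite eq_sym oner_eq0.
Qed.

Lemma gev_iter_kder p m y i : gev p m y -> gev p (m + (nu p - 1) * i%:Z) (iter i D y).
Proof.
move=> hy; elim: i => [|i IHi] /=; first by rewrite mulr0 addr0.
by apply: gevW (gev_kder HD IHi); lia.
Qed.

Lemma gev_det p M (A : 'M[K]_M) (r c : 'I_M -> int) :
  (forall i j, gev p (r i + c j) (A i j)) -> gev p (\sum_i r i + \sum_j c j) (\det A).
Proof.
move=> hA; apply: gev_sum => s _; apply: gevMl.
  by rewrite -signr_odd; case: odd; rewrite ?expr1 ?gevN gev1.
rewrite [X in _ + X](reindex_inj (@perm_inj _ s)) -big_split /=.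
by apply: gev_prod => i _; exact: hA.
Qed.

(** The Wronskian of [f] is that of [h] times a constant determinant, so any convenient spanning
    family may supply the column orders. The -1 per derivative is the source of the |S| term. *)
Lemma gev_wronskian p M (f h : 'I_M -> K) :
  (forall j, exists c : 'I_M -> k, f j = \sum_l iota (c l) * h l) ->
  gev p (\sum_j p (h j) + (nu p - 1) * (\sum_(i < M) i)%N%:Z) (wronskian f).
Proof.
move=> /choice[c hc].
have -> : wronskian f = wronskian h * iota (\det (\matrix_(l, j) c j l)).
  rewrite -det_map_mx -det_mulmx; congr (\det _); apply/matrixP => i j.
  rewrite !mxE hc iter_kder_lin; apply: eq_bigr => l _.
  by rewrite !mxE mulrC.
rewrite [wronskian h * _]mulrC; apply: gevZ.
rewrite (big_morph Posz PoszD erefl) mulr_sumr addrC.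
by apply: gev_det => i j; rewrite mxE addrC; apply: gev_iter_kder; exact: gev_refl.
Qed.

(** Subtracting the residue, which [D] kills, avoids the loss of one order. *)
Lemma gev_kder0 p y : gev p 0 y -> gev p (nu p) (D y).
Proof.
move=> /(residue HK)[c hc]; rewrite -(subrK (iota c) y) DD DC addr0.
by apply: gevW (gev_kder HD hc); lia.
Qed.

(** Coefficients of the i-th derivative of [h * y] in terms of the powers of [D / om] applied to
    [y]: a lower triangular array with diagonal [h * om ^+ i]. *)
Fixpoint twist_coef (h om : K) (i l : nat) : K :=
  if i is i'.+1 then
    D (twist_coef h om i' l) + (if l is l'.+1 then om * twist_coef h om i' l' else 0)
  else if l is 0 then h else 0.

Lemma twist_coef_gt h om i l : (i < l)%N -> twist_coef h om i l = 0.
Proof.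
elim: i l => [|i IHi] [|l] //= il; rewrite !IHi //; last exact: ltnW.
by rewrite mulr0 addr0 -(rmorph0 iota) DC rmorph0.
Qed.

Lemma twist_coef_diag h om i : twist_coef h om i i = h * om ^+ i.
Proof.
elim: i => [|i IHi] /=; first by rewrite expr0 mulr1.
by rewrite twist_coef_gt // -(rmorph0 iota) DC add0r IHi exprS mulrCA.
Qed.

Lemma iter_kder_twist h om y N i : om != 0 -> (i < N)%N ->
  iter i D (h * y) = \sum_(l < N) twist_coef h om i l * iter l (fun z => D z / om) y.
Proof.
move=> om0; elim: i => [|i IHi] iN /=.
  case: N iN => // N _; rewrite big_ord_recl /= big1 ?addr0 // => l _.
  by rewrite mul0r.
rewrite IHi ?(ltnW iN) // kder_sum.
under [LHS]eq_bigr => l _ do rewrite DM.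
under [RHS]eq_bigr => l _ do rewrite mulrDl.
rewrite !big_split /= addrC; congr (_ + _).
  by apply: eq_bigr => l _; rewrite mulrC.
case: N iN {IHi} => // N iN; rewrite big_ord_recr /= [RHS]big_ord_recl /= mul0r add0r.
rewrite twist_coef_gt // mul0r addr0; apply: eq_bigr => l _.
by rewrite add0n; field.
Qed.

(* At p, replace D by the derivation D / D (w p), which preserves the valuation ring,
   and divide all functions by one of order m: the change of Wronskian is triangular. *)
Lemma gev_wronskian_min p m M (f : 'I_M -> K) : (forall j, gev p m (f j)) ->
  gev p (m * M%:Z + nu p * (\sum_(i < M) i)%N%:Z) (wronskian f).
Proof.
move=> hf; have om0 := kder_w_neq0 HD p; set om := D (w p) in om0 *.
have [h h0 ph] : exists2 h, h != 0 & p h = m.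
  have w0 : w p != 0 by apply/eqP => w0; have := pval_w HD p; rewrite w0 pval0.
  case: m {hf} => n.
    by exists (w p ^+ n); rewrite ?expf_neq0 // pvalX (pval_w HD) natz.
  exists (w p ^- n.+1); first by rewrite invr_eq0 expf_neq0.
  by rewrite pvalV pvalX (pval_w HD) natz NegzE.
pose C := \matrix_(i < M, l < M) twist_coef h om i l.
pose D' z := D z / om.
have -> : wronskian f = \det C * \det (\matrix_(l < M, j < M) iter l D' (f j / h)).
  rewrite -det_mulmx; congr (\det _); apply/matrixP => i j; rewrite !mxE.
  rewrite -{1}[f j](divfK h0) mulrC (iter_kder_twist _ _ om0 (ltn_ord i)).
  by apply: eq_bigr => l _; rewrite !mxE.
have gD' l y : gev p 0 y -> gev p 0 (iter l D' y).
  move=> hy; elim: l => //= l /gev_kder0 hl.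
  by have := gevM hl (gev_refl p om^-1); rewrite pvalV subrr.
rewrite [\det C * _]mulrC; apply: gevMl.
  have h00 : 0 = \sum_(i < M) 0 + \sum_(j < M) 0 :> int by rewrite !big1 ?addr0.
  rewrite [X in gev _ X _]h00; apply: gev_det => i j; rewrite mxE addr0; apply: gD'.
  by have := gevM (hf j) (gev_refl p h^-1); rewrite pvalV ph subrr.
rewrite det_trig; last first.
  by apply/is_trig_mxP => i j ij; rewrite mxE twist_coef_gt.
rewrite (big_morph Posz PoszD erefl) mulr_sumr.
have -> : m * M%:Z = \sum_(i < M) m by rewrite big_const_ord iter_addr addr0 mulrn_int.
rewrite -big_split /=; apply: gev_prod => i _; rewrite mxE twist_coef_diag.
apply: gevM; first by rewrite -ph gev_refl.
by rewrite -mulrn_int gevX // gev_refl.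
Qed.

End Wronskian.

(** * Coefficients and monomials *)

Section Coefficients.
Variables (k : closedFieldType) (K : fieldType) (iota : {rmorphism k -> K}).
Variables (n : nat) (F : {mpoly K[n]}).
Implicit Types (p : place iota) (x y c : K) (s : nat).

Lemma mem_enum_mkset (T : finType) (P : pred T) i :
  (i \in enum [set j | P j]%classic) = P i.
Proof. by rewrite mem_enum; apply/idP/idP; rewrite inE. Qed.

Lemma mem_coefs m : F@_m != 0 -> F@_m \in coefs F.
Proof. by move=> Fm; rewrite mem_undup; apply/mapP; exists m => //; rewrite mcoeff_msupp. Qed.

Lemma coefs_neq0 c : c \in coefs F -> c != 0.
Proof. by rewrite mem_undup => /mapP[m + ->]; rewrite mcoeff_msupp. Qed.

Lemma minv_le p (r : seq K) c : c \in r -> minv p r <= p c.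
Proof.
rewrite /minv; move: (p _) => m0; elim: r => // a r IHr.
rewrite in_cons big_cons ge_min => /predU1P[->|/IHr->]; first by rewrite lexx.
by rewrite orbT.
Qed.

Lemma minv_eq0 p : (forall c, c \in coefs F -> p c = 0) -> minv p (coefs F) = 0.
Proof.
rewrite /minv => h; rewrite big_seq.
have -> : p (head 0 (coefs F)) = 0.
  by case: (coefs F) h => [|c r] h /=; [rewrite pval0 | rewrite h ?mem_head].
by elim/big_rec: _ => // c m /h-> ->; rewrite minxx.
Qed.

Lemma gensVP s x : x \in gensV F s <-> exists e : 'I_(size (coefs F)) -> nat,
  (\sum_i e i = s)%N /\ x = \prod_(i < size (coefs F)) (coefs F)`_i ^+ e i.
Proof.
split=> [/mapP[e + ->]|[e [se ->]]].
  by rewrite mem_enum_mkset => /eqP se; exists (fun i => nat_of_ord (e i)).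
apply/mapP; exists [ffun i => inord (e i)].
  rewrite mem_enum_mkset -[X in _ == X]se; apply/eqP/eq_bigr => i _.
  by rewrite ffunE inordK // ltnS -se (bigD1 i) //= leq_addr.
rewrite /=; apply: eq_bigr => i _.
by rewrite ffunE inordK // ltnS -se (bigD1 i) //= leq_addr.
Qed.

Lemma gensV_neq0 s x : x \in gensV F s -> x != 0.
Proof.
move/gensVP => [e [_ ->]]; apply/prodf_neq0 => i _; rewrite expf_neq0 //.
by apply: coefs_neq0; apply: mem_nth.
Qed.

Lemma gev_gensV p s x : x \in gensV F s -> gev p (minv p (coefs F) * s%:Z) x.
Proof.
move/gensVP => [e [<- ->]]; rewrite (big_morph Posz PoszD erefl) mulr_sumr.
apply: gev_prod => i _; rewrite -mulrn_int gevX //.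
by rewrite /gev minv_le ?orbT //; apply: mem_nth.
Qed.

Lemma gensV_mul s x c : c \in coefs F -> x \in gensV F s -> c * x \in gensV F s.+1.
Proof.
move=> cF /gensVP[e [se ->]]; apply/gensVP.
have ic : (index c (coefs F) < size (coefs F))%N by rewrite index_mem.
exists (fun i => (e i + (i == Ordinal ic))%N); split.
  rewrite big_split /= se (bigD1 (Ordinal ic)) //= eqxx big1 ?addn0 ?addn1 //.
  by move=> i /negPf->.
under [RHS]eq_bigr => i _ do rewrite exprD.
rewrite big_split /= mulrC; congr (_ * _).
rewrite (bigD1 (Ordinal ic)) //= eqxx expr1 nth_index // big1 ?mulr1 //.
by move=> i /negPf->; rewrite expr0.
Qed.

Hypothesis F1 : exists m, F@_m = 1.

Lemma one_coef : 1 \in coefs F.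
Proof. by have [m Fm] := F1; rewrite -Fm mem_coefs // Fm oner_neq0. Qed.

Lemma gensVS s x : x \in gensV F s -> x \in gensV F s.+1.
Proof. by move=> /(gensV_mul one_coef); rewrite mul1r. Qed.

Lemma gensV_1 s : 1 \in gensV F s.
Proof.
elim: s => [|s /gensVS//]; apply/gensVP; exists (fun=> 0%N).
by rewrite !big1 // => i _; rewrite expr0.
Qed.

Lemma minv_le0 p : minv p (coefs F) <= 0.
Proof. by rewrite -(pval1 p) minv_le // one_coef. Qed.

Variables (g : 'I_n -> K) (d : nat).

Definition expo : seq {ffun 'I_n -> 'I_d.+1} :=
  enum [set i : {ffun 'I_n -> 'I_d.+1} | (\sum_(j < n) (i j : nat) <= d)%N]%classic.
Definition gmon (i : {ffun 'I_n -> 'I_d.+1}) : K := \prod_(j < n) g j ^+ (i j : nat).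
Definition mnm_of (i : {ffun 'I_n -> 'I_d.+1}) : 'X_{1..n} := [multinom (i j : nat) | j < n].
Definition expo0 : {ffun 'I_n -> 'I_d.+1} := [ffun=> ord0].

Lemma size_expo : size expo = 'C(n + d, n).
Proof.
rewrite -card_partial_ord_partitions -cardE.
pose f (i : {ffun 'I_n -> 'I_d.+1}) : n.-tuple 'I_d.+1 := [tuple i j | j < n].
have f_inj : injective f.
  by move=> i j /(congr1 (fun u => tnth u)) e; apply/ffunP => l; have := congr1 (@^~ l) e; rewrite !tnth_mktuple.
have bf : bijective f by apply: inj_card_bij => //; rewrite card_ffun card_tuple !card_ord.
have [f' fK f'K] := bf.
rewrite -(on_card_preimset (f := f)); last by apply: onW_bij.
apply: eq_card => i; rewrite !inE.
have -> : (\sum_(j <- f i) j = \sum_(j < n) i j)%N.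
  by rewrite big_tuple; apply: eq_bigr => j _; rewrite tnth_mktuple.
by apply/idP/idP; rewrite inE.
Qed.

Lemma mem_expo i : (i \in expo) = (\sum_(j < n) (i j : nat) <= d)%N.
Proof. exact: mem_enum_mkset. Qed.

Lemma expo_uniq : uniq expo.
Proof. exact: enum_uniq. Qed.

Lemma expo0_mem : expo0 \in expo.
Proof. by rewrite mem_expo big1 // => j _; rewrite ffunE. Qed.

Lemma gmon0 : gmon expo0 = 1.
Proof. by rewrite /gmon big1 // => j _; rewrite ffunE expr0. Qed.

Lemma mnm_of0 : mnm_of expo0 = 0%MM.
Proof. by apply/mnmP => j; rewrite mnmE ffunE mnm0E. Qed.

Lemma meval_gmon : msize F = d.+1 ->
  F.@[g] = \sum_(i <- expo) F@_(mnm_of i) * gmon i.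
Proof.
move=> sF; rewrite mevalE.
have mnm_inj : injective mnm_of.
  by move=> i j /mnmP e; apply/ffunP => l; apply: val_inj; have := e l; rewrite !mnmE.
have pe : perm_eq (msupp F) [seq mnm_of i | i <- expo & mnm_of i \in msupp F].
  apply: uniq_perm; first exact: msupp_uniq.
    by rewrite map_inj_uniq // filter_uniq // expo_uniq.
  move=> m; apply/idP/mapP => [mF|[i + ->]]; last by rewrite mem_filter => /andP[].
  have le_m : (mdeg m <= d)%N by rewrite -ltnS -sF msize_mdeg_lt.
  have mE : m = mnm_of [ffun j => inord (m j)].
    apply/mnmP => j; rewrite mnmE ffunE inordK // ltnS.
    by apply: leq_trans le_m; rewrite mdegE (bigD1 j) //= leq_addr.
  exists [ffun j => inord (m j)] => //; rewrite mem_filter -mE mF /= mem_expo.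
  apply: leq_trans le_m; rewrite mdegE {2}mE; apply: eq_leq.
  by apply: eq_bigr => j _; rewrite mnmE.
rewrite (perm_big _ pe) big_map big_filter [RHS](bigID (fun i => mnm_of i \in msupp F)) /=.
rewrite [X in _ = _ + X]big1 ?addr0 => [|i /memN_msupp_eq0->]; last by rewrite mul0r.
apply: eq_bigr => i _; congr (_ * _); apply: eq_bigr => j _.
by rewrite mnmE.
Qed.

End Coefficients.

(** * The main inequality *)

Lemma sum_const_int (T : Type) (s : seq T) (a : int) : \sum_(x <- s) a = (size s)%:Z * a.
Proof. by rewrite big_const_seq count_predT iter_addr_0 mulrn_int mulrC. Qed.

Section MainInequality.
Variables (k : closedFieldType) (K : fieldType) (iota : {rmorphism k -> K}).
Hypothesis char0 : [pchar k] =i pred0.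
Hypothesis HK : is_function_field iota.
Variables (gen : nat) (Hgen : is_genus iota gen).
Variables (S : seq (place iota)) (uS : uniq S).
Variables (n d : nat) (F : {mpoly K[n]}) (degF : msize F = d.+1).
Hypotheses (F0 : F@_0%MM != 0) (F1 : exists m, F@_m = 1).
Variables (g : 'I_n -> K) (gS : forall i, OSunit S (g i)).
Variables (r : nat) (nondeg : lin_nondeg (inV iota F r.+1) (gmonos g d)).
Implicit Types (p : place iota) (x y : K).

Local Notation expo := (expo n d).
Local Notation gmon := (@gmon K n g d).
Local Notation expo0 := (expo0 n d).

Lemma gmon_neq0 i : gmon i != 0.
Proof. by apply/prodf_neq0 => j _; rewrite expf_neq0 //; case: (gS j). Qed.

Lemma pval_gmon p i : p \notin S -> p (gmon i) = 0.
Proof.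
move=> pS; rewrite pval_prod => [|j _]; last by rewrite expf_neq0 //; case: (gS j).
by rewrite big1 // => j _; rewrite pvalX; case: (gS j) => _ ->; rewrite ?mul0rn.
Qed.

Lemma nondeg_expo (a : {ffun 'I_n -> 'I_d.+1} -> K) : (forall i, inV iota F r.+1 (a i)) ->
  \sum_(i <- expo) a i * gmon i = 0 -> forall i, i \in expo -> a i = 0.
Proof.
move=> aV sum0 i ie; have szE : size (gmonos g d) = size expo by rewrite size_map.
have ig : (index i expo < size (gmonos g d))%N by rewrite szE index_mem.
have := nondeg (a := fun j => a (nth expo0 expo j)) (fun j => aV _) _ (Ordinal ig).
rewrite /= nth_index //; apply; rewrite -[RHS]sum0 (big_nth expo0).
rewrite -szE big_mkord; apply: eq_bigr => j _.
by rewrite (nth_map expo0) // -szE.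
Qed.

Lemma coef_inV m : inV iota F r.+1 (F@_m).
Proof.
have [->|Fm] := eqVneq F@_m 0; first exact: kspan0.
apply: kspan_mem; rewrite -[F@_m]mulr1; apply: gensV_mul; first exact: mem_coefs.
exact: gensV_1.
Qed.

(** Because 1 is a coefficient, all coefficients of [F] lie in the space of the nondegeneracy
    hypothesis; F(g) = 0 would force them to vanish, against F(0) != 0. *)
Lemma meval_neq0 : F.@[g] != 0.
Proof.
apply/negP => /eqP; rewrite (meval_gmon _ degF) => sum0.
have := @nondeg_expo (fun i => F@_(mnm_of i)) (fun i => coef_inV _) sum0 expo0 (expo0_mem n d).
by rewrite mnm_of0 => /eqP; rewrite (negPf F0).
Qed.

(** Grouped by monomials, a relation over [k] becomes one with coefficients in V_F(r + 1), where
    nondegeneracy and then freeness of [B] apply. *)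
Lemma kfree_products (B : seq K) : kfree iota B -> (forall b, b \in B -> inV iota F r.+1 b) ->
  kfree iota [seq b * gmon i | b <- B, i <- expo].
Proof.
move=> fB BV.
pose u := [seq B`_(val z.1) * gmon (nth expo0 expo (val z.2))
  | z : 'I_(size B) * 'I_(size expo) <- enum {: 'I_(size B) * 'I_(size expo)}].
have fu : kfree iota u.
  apply: kfree_map_enum => c hc [l0 j0].
  pose a i : K := if insub (index i expo) is Some j then \sum_(l < size B) iota (c (l, j)) * B`_l else 0.
  have aE (j : 'I_(size expo)) : a (nth expo0 expo j) = \sum_(l < size B) iota (c (l, j)) * B`_l.
    by rewrite /a index_uniq ?expo_uniq // valK.
  have a0 : a (nth expo0 expo j0) = 0.
    apply: nondeg_expo; last exact: mem_nth.
      move=> i; rewrite /a; case: insubP => [j _ _|_]; last exact: kspan0.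
      by apply: kspan_sum => l _; apply: kspanZ; apply: BV; exact: mem_nth.
    rewrite (big_nth expo0) big_mkord -[RHS]hc.
    rewrite (eq_bigr (fun j => \sum_(l < size B) iota (c (l, j)) * (B`_l * gmon (nth expo0 expo j)))).
      by rewrite exchange_big pair_big; apply: eq_bigr => -[l j].
    by move=> j _; rewrite aE mulr_suml; apply: eq_bigr => l _; rewrite mulrA.
  by rewrite aE in a0; exact: (fB (fun l => c (l, j0)) a0 l0).
apply: (kfree_of_size fu) => [x /mapP[[l j] _ ->] /=|].
  by apply: kspan_mem; apply: allpairs_f; apply: mem_nth.
by rewrite size_allpairs size_map -[X in (_ <= X)%N]cardE card_prod !card_ord.
Qed.

(* F(g) replaces its own constant term: the products beta * F(g), a complement of
   F(0) V_F(r) in V_F(r+1) and the b * g^i with i != 0 still span everything. *)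
Lemma replaced_basis (B B' : seq K) : kfree iota B -> {subset B <= gensV F r.+1} ->
  (forall b, inV iota F r.+1 b -> in_kspan iota B b) ->
  kfree iota B' -> {subset B' <= gensV F r} ->
  exists w, [/\ {subset w <= B}, (size B' + size w)%N = size B &
    forall b i, b \in B -> i \in expo -> in_kspan iota
      ([seq b * F.@[g] | b <- B'] ++ w ++ [seq b * gmon i | b <- B, i <- [seq i <- expo | i != expo0]])
      (b * gmon i)].
Proof.
move=> fB BV spB fB' B'V; set third := [seq _ | _ <- B, _ <- _].
pose a0 := F@_0%MM; have a0F : a0 \in coefs F by exact: mem_coefs.
pose u := [seq a0 * b | b <- B'].
have fu : kfree iota u.
  move/kfreeP: fB' => fB'; apply/kfreeP => c; rewrite size_map => hs; apply: (fB' c).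
  apply: (mulfI F0); rewrite mulr0 mulr_sumr -[RHS]hs; apply: eq_bigr => i _.
  by rewrite (nth_map 0) // mulrCA.
have uV x : x \in u -> in_kspan iota B x.
  by move=> /mapP[b bB' ->]; apply: spB; apply: kspan_mem; apply: gensV_mul => //; exact: B'V.
have [w [/mem_subseq wB fuw spw]] := kfree_extend B fu.
have sz : (size B' + size w)%N = size B.
  have -> : (size B' + size w)%N = size (u ++ w) by rewrite size_cat size_map.
  apply/eqP; rewrite eqn_leq (kspan_size fB spw) andbT; apply: kspan_size fuw _.
  by move=> x; rewrite mem_cat => /orP[/uV//|/wB]; exact: kspan_mem.
exists w; split=> // b i bB ie; set h := _ ++ _.
have thirdP c j : inV iota F r.+1 c -> j \in expo -> j != expo0 -> in_kspan iota h (c * gmon j).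
  move=> /spB[e ->] je j0; rewrite mulr_suml; apply: kspan_sum => l _.
  rewrite -mulrA; apply: kspanZ; apply: kspan_mem; rewrite !mem_cat; apply/orP; right.
  apply/orP; right; apply: allpairs_f; first exact: mem_nth.
  by rewrite mem_filter j0.
have [->|i0] := eqVneq i expo0; last first.
  by apply: thirdP => //; apply: kspan_mem; exact: BV.
rewrite gmon0 mulr1; apply: kspan_trans (spw b bB) => x; rewrite mem_cat => /orP[|xw]; last first.
  by apply: kspan_mem; rewrite !mem_cat xw orbT.
move=> /mapP[c cB' ->].
(* The expansion of F(g) is solved for its constant term; multiplied by [c] in V_F(r), every other
   coefficient lands in V_F(r + 1). *)
have -> : a0 * c = c * F.@[g] - \sum_(j <- expo | j != expo0) (F@_(mnm_of j) * c) * gmon j.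
  rewrite (meval_gmon _ degF) (bigD1_seq expo0) ?expo0_mem ?expo_uniq //=.
  rewrite gmon0 mulr1 mnm_of0 mulrDr mulr_sumr.
  rewrite [X in _ + X - _](eq_bigr (fun j => F@_(mnm_of j) * c * gmon j)) => [|j _]; last by ring.
  by rewrite addrK mulrC.
apply: kspanB; first by apply: kspan_mem; rewrite mem_cat; apply/orP; left; apply/mapP; exists c.
rewrite -big_filter big_seq; apply: kspan_sum => j; rewrite mem_filter => /andP[j0 je].
apply: thirdP => //; have [->|Fm] := eqVneq F@_(mnm_of j) 0; first by rewrite mul0r; exact: kspan0.
by apply: kspan_mem; apply: gensV_mul; [exact: mem_coefs | exact: B'V].
Qed.

Lemma gev_wronskian_list D (w : place iota -> K) (HD : derivation_data D w) p (f h : seq K) :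
  size h = size f -> (forall x, x \in f -> in_kspan iota h x) ->
  gev p (\sum_(x <- h) p x + (p (D (w p)) - 1) * (\sum_(i < size f) i)%N%:Z)
    (wronskian D (fun j : 'I_(size f) => f`_j)).
Proof.
move=> sz fh; rewrite (big_nth 0) big_mkord sz.
apply: (gev_wronskian HD) => j.
have /kspanP[c ->] : in_kspan iota h f`_j by apply: fh; exact: mem_nth.
by exists (fun l => c l); rewrite sz.
Qed.

Local Notation mu p := (minv p (coefs F)).

Lemma order_products p (B Y : seq K) : {subset B <= gensV F r.+1} ->
  (forall y, y \in Y -> y != 0) ->
  mu p * r.+1%:Z * (size B * size Y)%N%:Z + (size B)%:Z * \sum_(y <- Y) p y
  <= \sum_(x <- [seq b * y | b <- B, y <- Y]) p x.
Proof.
move=> BV Y0; elim: B BV => [|b B IHB] BV.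
  by rewrite !big_nil mul0n mulr0 mul0r.
rewrite /= big_cat /= big_map mulSn.
have bV : b \in gensV F r.+1 by apply: BV; rewrite mem_head.
have b0 := gensV_neq0 bV; have := gev_gensV p bV; rewrite gevE // => pb.
have -> : \sum_(y <- Y) p (b * y) = p b * (size Y)%:Z + \sum_(y <- Y) p y.
  rewrite big_seq (eq_bigr (fun y => p b + p y)) => [|y yY]; last by rewrite pvalM // Y0.
  by rewrite -big_seq big_split /= sum_const_int mulrC.
have := IHB (fun x xB => BV x (mem_behead (s := b :: B) xB)).
rewrite PoszD -[(size B).+1]addn1 [in X in _ -> _ + X * _ <= _]PoszD.
move: pb; set P := _ * r.+1%:Z; set sY := \sum_(y <- Y) p y; set sB := \sum_(_ <- _) _.
by rewrite PoszM; nia.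
Qed.

Lemma sum_subset_cond (T S' : seq (place iota)) (G : place iota -> int) :
  uniq T -> uniq S' -> {subset S' <= T} ->
  \sum_(p <- T) (if p \in S' then G p else 0) = \sum_(p <- S') G p.
Proof.
move=> uT uS' sub; rewrite -big_mkcond -big_filter; apply: perm_big.
apply: uniq_perm => // [|p]; first exact: filter_uniq.
by rewrite mem_filter; apply/andP/idP => [[]//|pS']; split=> //; exact: sub.
Qed.

(** In this section [r] is one less than the r of the theorem. The sum of the local bounds over a
    large finite set [T] is at most the degree of (W), which is zero. *)
Lemma main_inequality q : q \in S ->
  forall M, M = (dimV iota F r.+1 * size expo)%N ->
  (dimV iota F r)%:Z * \sum_(p <- S) Num.max 0 (p F.@[g])
  <= M%:Z * r.+1%:Z * hpoly iota F
     + (\sum_(i < M) i)%N%:Z * (2 * gen%:Z - 2 + (size S)%:Z).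
Proof.
move=> qS M ME; have [D [w [HD nuT]]] := canonical_derivation Hgen HK char0 q.
have [B [BV fB spB' szB]] := kdim_basis iota (gensV F r.+1).
have [B' [B'V fB' _ szB']] := kdim_basis iota (gensV F r).
have spB b : inV iota F r.+1 b -> in_kspan iota B b by exact: kspan_trans.
pose f := [seq b * gmon i | b <- B, i <- expo].
have ff : kfree iota f by apply: kfree_products => // b /BV; exact: kspan_mem.
have szf : size f = M by rewrite size_allpairs ME /dimV szB.
pose W := wronskian D (fun j : 'I_(size f) => f`_j).
have W0 : W != 0 by apply: (wronskian_neq0 HD) => c hc; exact: ff.
pose C : int := (\sum_(i < M) i)%N.
have CE : C = (\sum_(i < size f) i)%N by rewrite szf.
pose Y p := \sum_(i <- expo) p (gmon i).
have gmY0 (l : seq {ffun 'I_n -> 'I_d.+1}) y : y \in [seq gmon i | i <- l] -> y != 0.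
  by move=> /mapP[i _ ->]; exact: gmon_neq0.
have order_f p : M%:Z * r.+1%:Z * mu p + (size B)%:Z * Y p <= \sum_(x <- f) p x.
  have := @order_products p B [seq gmon i | i <- expo] BV (@gmY0 _).
  rewrite size_map big_map -/(Y p) allpairs_mapr -/f.
  by apply: le_trans; rewrite lerD2r ME /dimV szB; lia.
(* If F(g) does not vanish at [p], the family [f] itself supplies the column orders; otherwise the
   family of [replaced_basis] does. *)
have lbS p : p \in S -> (size B')%:Z * Num.max 0 (p F.@[g]) + M%:Z * r.+1%:Z * mu p
    + (size B)%:Z * Y p + (p (D (w p)) - 1) * C <= p W.
  move=> pS; rewrite CE.
  have [le0|gt0] := lerP (p F.@[g]) 0.
    have := @gev_wronskian_list D w HD p f f erefl (fun x => @kspan_mem _ _ iota f x).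
    rewrite -/W gevE //; apply: le_trans; rewrite mulr0 add0r lerD2r.
    exact: order_f.
  have [w' [w'B szw' sph]] := replaced_basis fB BV spB fB' B'V.
  pose expo' := [seq i <- expo | i != expo0].
  have sze' : (size expo' + 1)%N = size expo.
    rewrite /expo' -rem_filter ?expo_uniq // size_rem ?expo0_mem // addn1 prednK //.
    by have := expo0_mem n d; case: expo.
  set h := _ ++ _ in sph.
  have szh : size h = size f.
    rewrite !size_cat size_map !size_allpairs -/expo' addnA szw' -sze' /f.
    by rewrite mulnDr muln1 addnC.
  have fh x : x \in f -> in_kspan iota h x.
    by move=> /allpairsP[[b i] /= [bB ie ->]]; exact: sph.
  have := gev_wronskian_list HD p szh fh.
  rewrite -/W gevE //; apply: le_trans; rewrite lerD2r /h !big_cat /=.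
  have Fg0 := meval_neq0; have mu0 := minv_le0 F1 p.
  have h1 : (size B')%:Z * (p F.@[g] + mu p * r.+1%:Z) <= \sum_(x <- [seq b * F.@[g] | b <- B']) p x.
    rewrite big_map -sum_const_int.
    rewrite big_seq [leRHS]big_seq; apply: ler_sum => b bB'.
    have b0 := gensV_neq0 (B'V b bB'); rewrite pvalM // addrC lerD2r.
    have := gev_gensV p (B'V b bB'); rewrite gevE //; apply: le_trans.
    by rewrite ler_wnM2l // lez_nat.
  have h2 : (size w')%:Z * (mu p * r.+1%:Z) <= \sum_(x <- w') p x.
    rewrite -sum_const_int.
    rewrite big_seq [leRHS]big_seq; apply: ler_sum => b /w'B/BV bV.
    by have := gev_gensV p bV; rewrite gevE // (gensV_neq0 bV).
  have h3 := @order_products p B [seq gmon i | i <- expo'] BV (@gmY0 _).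
  rewrite size_map big_map allpairs_mapr in h3.
  have YE : \sum_(i <- expo') p (gmon i) = Y p.
    rewrite /Y [RHS](bigD1_seq expo0) ?expo0_mem ?expo_uniq //= gmon0 pval1 add0r.
    by rewrite big_filter.
  rewrite YE in h3; apply: le_trans (lerD h1 (lerD h2 h3)).
  by rewrite ME /dimV szB -sze' -szw' !(PoszM, PoszD); rewrite le_eqVlt; apply/orP; left; apply/eqP; ring.
(* Off [S] the monomials are units, so every column has order at least r + 1 times the minimum for
   [F], and the sharper estimate with nu in place of nu - 1 applies. *)
have lbN p : p \notin S -> M%:Z * r.+1%:Z * mu p + p (D (w p)) * C <= p W.
  move=> pS; rewrite CE.
  have hf (j : 'I_(size f)) : gev p (mu p * r.+1%:Z) f`_j.
    have /allpairsP[[b i] /= [bB _ ->]] : f`_j \in f by exact: mem_nth.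
    rewrite -[X in gev _ X]addr0; apply: gevM; first exact: gev_gensV (BV b bB).
    by rewrite gevE ?gmon_neq0 // pval_gmon.
  have := gev_wronskian_min HK HD hf.
  rewrite -/W gevE // szf; apply: le_trans; rewrite le_eqVlt; apply/orP; left; apply/eqP.
  by rewrite [_ * M%:Z]mulrC -mulrA [r.+1%:Z * _]mulrC.
have /choice[sup hsup] : forall x : K, exists s : seq (place iota), forall p, p \notin s -> p x = 0.
  by move=> x; have [s [_ hs]] := pval_support Hgen HK x; exists s.
(* The bound on the divisor of [D] holds over every finite set containing [q], so [T] is dictated
   only by [S], [W] and the coefficients of [F]. *)
pose T := undup (S ++ sup W ++ flatten [seq sup c | c <- coefs F]).
have uT : uniq T by exact: undup_uniq.
have ST : {subset S <= T} by move=> p pS; rewrite mem_undup mem_cat pS.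
have sumW : \sum_(p <- T) p W = 0.
  apply: (sum_pval_eq0 Hgen W0 uT) => p; rewrite mem_undup !mem_cat => /norP[_ /norP[pW _]].
  exact: hsup.
have sum_mu : \sum_(p <- T) mu p = - hpoly iota F.
  rewrite /hpoly opprK; apply/esym/fsum_supported => // p.
  rewrite mem_undup !mem_cat => /norP[_ /norP[_ pF]]; apply: minv_eq0 => c cF.
  by apply: hsup; apply: contra pF => pc; apply/flatten_mapP; exists c.
have sumY : \sum_(p <- S) Y p = 0.
  rewrite /Y exchange_big big1 //= => i _.
  apply: (sum_pval_eq0 Hgen (gmon_neq0 i) uS) => p; exact: pval_gmon.
pose G p : int := (size B')%:Z * Num.max 0 (p F.@[g]) + (size B)%:Z * Y p - C.
have lb : \sum_(p <- T) (M%:Z * r.+1%:Z * mu p + p (D (w p)) * C + (if p \in S then G p else 0)) <= 0.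
  rewrite -[X in _ <= X]sumW; apply: ler_sum => p _; case: ifP => pS.
    by apply: le_trans (lbS p pS); rewrite le_eqVlt; apply/orP; left; apply/eqP; rewrite /G; ring.
  by rewrite addr0; apply: lbN; rewrite pS.
have sumG : \sum_(p <- T) (if p \in S then G p else 0) =
    (size B')%:Z * \sum_(p <- S) Num.max 0 (p F.@[g]) - C * (size S)%:Z.
  rewrite sum_subset_cond // /G !big_split /= -!mulr_sumr sumY mulr0 addr0.
  by rewrite sumrN sum_const_int [C * _]mulrC.
move: lb; rewrite !big_split /= -mulr_sumr -mulr_suml sum_mu sumG.
have C0 : 0 <= C by [].
have := ler_wpM2r C0 (nuT T uT (ST q qS)).
rewrite /dimV szB' -/C; set E := \sum_(p <- S) _; set N := \sum_(p <- T) _.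
move=> leN lb; nia.
Qed.

End MainInequality.

Section Nonnegativity.
Variables (k : closedFieldType) (K : fieldType) (iota : {rmorphism k -> K}).
Variables (n : nat) (F : {mpoly K[n]}) (F1 : exists m, F@_m = 1).

Lemma dimV_gt0 s : (0 < dimV iota F s)%N.
Proof.
have [B [BV _ sp szB]] := kdim_basis iota (gensV F s); rewrite /dimV szB.
have f1 : kfree iota [:: 1 : K].
  by move=> c; rewrite /= big_ord1 mulr1 => /eqP; rewrite fmorph_eq0 => /eqP h i; rewrite ord1.
apply: (kspan_size f1) => x; rewrite inE => /eqP->; apply: sp; exact: gensV_1.
Qed.

Lemma dimV_leS s : (dimV iota F s <= dimV iota F s.+1)%N.
Proof.
have [B [BV fB _ szB]] := kdim_basis iota (gensV F s).
have [B' [_ _ sp szB']] := kdim_basis iota (gensV F s.+1).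
rewrite /dimV szB szB'; apply: kspan_size fB _ => x /BV xV.
by apply: sp; exact: gensVS.
Qed.

Lemma hpoly_ge0 : 0 <= hpoly iota F.
Proof.
rewrite /hpoly -sumrN; apply: sumr_ge0 => p _.
by rewrite oppr_ge0 minv_le0.
Qed.

End Nonnegativity.

(** Passage to the stated form: the term in [Z] has the factor a / b - 1 >= 0, and r is enlarged to
    r + 1 in front of [h]. *)
Lemma rational_bound (a b N r h E Y Z : rat) : 0 < b -> b <= a -> 0 <= N -> 1 <= a -> 0 <= h ->
  0 <= Z ->
  E * b <= a * (N + 1) * r * h + a * (N + 1) * (N * a + a - 1) / 2 * Y ->
  E <= (a / b - 1) * (N + 1) * Z + a * (N + 1) / b * (r + 1) * h
     + a * (N + 1) * (N * a + a - 1) / (2 * b) * Y.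
Proof.
move=> b0 ba N0 a1 h0 Z0 hE.
have -> : (a / b - 1) * (N + 1) * Z + a * (N + 1) / b * (r + 1) * h
     + a * (N + 1) * (N * a + a - 1) / (2 * b) * Y
  = ((a - b) * (N + 1) * Z + a * (N + 1) * (r + 1) * h
     + a * (N + 1) * (N * a + a - 1) / 2 * Y) / b.
  by field; rewrite gt_eqF.
rewrite ler_pdivlMr //; apply: le_trans hE _.
have P1 : 0 <= (a - b) * (N + 1) * Z by rewrite !mulr_ge0 ?subr_ge0 //; lra.
have P2 : 0 <= a * (N + 1) * h by rewrite !mulr_ge0 //; lra.
by lra.
Qed.

Theorem theorem6p4 (k : closedFieldType) (K : fieldType)
  (iota : {rmorphism k -> K})
  (char0 : [pchar k] =i pred0)
  (HK : is_function_field iota)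
  (gen : nat) (Hgen : is_genus iota gen)
  (S : seq (place iota)) (uS : uniq S)
  (n d : nat) (F : {mpoly K[n]})
  (d_pos : (0 < d)%N) (degF : msize F = d.+1)
  (F0 : F@_0%MM != 0) (F1 : exists m, F@_m = 1)
  (g : 'I_n -> K) (gS : forall i, OSunit S (g i))
  (r : nat) (r_pos : (0 < r)%N)
  (nondeg : lin_nondeg (inV iota F r) (gmonos g d)) :
  let N := ('C(n + d, n)).-1 in
  let dr : rat := (dimV iota F r)%:R in
  let dr1 : rat := (dimV iota F r.-1)%:R in
  let maxh : rat := (\big[Num.max/0]_(i < n) hgt iota (g i))%:~R in
  (\sum_(p <- S) v0 p (F.@[g]) <=
    ((dr / dr1 - 1) * (N.+1)%:R * d%:R * n%:R * maxh
     + dr * (N.+1)%:R / dr1 * (r.+1)%:R * (hpoly iota F)%:~R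
     + dr * (N.+1)%:R * (N%:R * dr + dr - 1) / (2 * dr1)
       * (Num.max 0 (2 * gen%:Z - 2 + (size S)%:Z))%:~R)%:E)%E.
Proof.
case: r r_pos nondeg => // r _ nondeg; lazy zeta; rewrite /=.
set N := _.-1; set dr : rat := (dimV iota F r.+1)%:R; set dr1 : rat := (dimV iota F r)%:R.
set maxh : rat := (\big[Num.max/0]_(i < n) _)%:~R.
have Fg0 : F.@[g] != 0 by exact: (meval_neq0 degF F0 F1 nondeg).
set E := \sum_(p <- S) Num.max 0 (p F.@[g]).
have -> : (\sum_(p <- S) v0 p F.@[g] = (E%:~R)%:E)%E.
  rewrite /E rmorph_sum -sumEFin; apply: eq_bigr => p _.
  by rewrite /v0 (negPf Fg0).
rewrite lee_fin.
have dr1_ge1 : 1 <= dr1 by rewrite ler1n dimV_gt0.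
have dr1_le : dr1 <= dr by rewrite ler_nat dimV_leS.
have maxh0 : 0 <= maxh.
  by rewrite ler0z; elim/big_rec: _ => // i x _ x0; rewrite le_max x0 orbT.
have NE : N.+1 = size (expo n d) by rewrite size_expo prednK // bin_gt0 leq_addr.
have X0 : 0 <= (Num.max 0 (2 * gen%:Z - 2 + (size S)%:Z))%:~R :> rat.
  by rewrite ler0z le_max lexx.
set X := Num.max 0 _ in X0 *.
have dr_ge1 := le_trans dr1_ge1 dr1_le.
have h0 : 0 <= (hpoly iota F)%:~R :> rat by rewrite ler0z hpoly_ge0.
have N1 : 0 <= N%:R + 1 :> rat by rewrite addr_ge0 ?ler0n.
have dr0 := le_trans ler01 dr_ge1.
have C0 : 0 <= dr * (N%:R + 1) * (N%:R * dr + dr - 1) / 2.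
  have Ndr : 0 <= N%:R * dr by rewrite mulr_ge0 ?ler0n // (le_trans ler01).
  have h1 : 0 <= N%:R * dr + dr - 1 by lra.
  by rewrite !mulr_ge0 // invr_ge0.
have main : E%:~R * dr1 <= dr * (N%:R + 1) * r.+1%:R * (hpoly iota F)%:~R
    + dr * (N%:R + 1) * (N%:R * dr + dr - 1) / 2 * X%:~R.
  (* With [S] empty there is no point to serve as [q], but the left side is zero and the right side
     nonnegative. *)
  have [S0|[q qS]] : S = [::] \/ exists q, q \in S.
    by case: (S) => [|q S']; [left | right; exists q; rewrite mem_head].
    rewrite /E S0 big_nil mul0r addr_ge0 //; last exact: mulr_ge0.
    by rewrite !mulr_ge0 ?ler0n.
  have := main_inequality char0 HK Hgen uS degF F0 F1 gS nondeg qS erefl.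
  rewrite -NE -/E; set X' : int := _ - 2 + _ => hE.
  have XX : X'%:~R <= X%:~R :> rat by rewrite ler_int le_max lexx orbT.
  move: X' XX hE => X' XX; rewrite -(ler_int rat) !(rmorphD, rmorphM) /= -!pmulrn.
  set M := (_ * N.+1)%N => hE.
  (* M (M - 1) / 2 with M = d_r (N + 1), the total number of derivatives in the rows of the
     Wronskian. *)
  have CE : (\sum_(i < M) i)%N%:R = dr * (N%:R + 1) * (N%:R * dr + dr - 1) / 2 :> rat.
    have M0 : (0 < M)%N by rewrite muln_gt0 dimV_gt0.
    apply: (@mulfI _ 2%:R); first by rewrite pnatr_eq0.
    rewrite -natrM double_sum_ord natrM -subn1 natrB //.
    have -> : M%:R = dr * (N%:R + 1) by rewrite natrM -natr1.
    by field.
  rewrite -CE mulrC; apply: le_trans hE _; rewrite -!natr1.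
  by apply: lerD => //; apply: ler_wpM2l; rewrite ?ler0n.
have Z0 : 0 <= d%:R * n%:R * maxh by rewrite !mulr_ge0 // ler0n.
have := rational_bound (lt_le_trans ltr01 dr1_ge1) dr1_le (ler0n _ N) dr_ge1 h0 Z0 main.
by rewrite -!natr1 => /le_trans; apply; rewrite !mulrA.
Qed.
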